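(* Let $\bm n\in\mathbb N^r$, $\beta\in\mathbb Z_{\ge0}$, and let $\bm\alpha=(\alpha_1,\dots,\alpha_r)$ satisfy $\alpha_1,\dots,\alpha_r>-1$ and $\alpha_i-\alpha_j\notin\mathbb Z$ for $i\neq j$. For each $i\in\{1,\dots,r\}$ and each $0\le t\le2$ such that $$\alpha_i-\alpha_j+t\notin\mathbb Z\quad\text{for all } j\neq i,$$ the Type II Jacobi–Piñeiro polynomials satisfy the interlacing $$P^{(\bm\alpha;\beta)}_{\bm n+\bm e_i}\preccurlyeq P^{(\bm\alpha;\beta)}_{\bm n}\preccurlyeq P^{(\bm\alpha+t\bm e_i;\beta)}_{\bm n}.$$
   Context: $\mathbb N=\{1,2,\dots\}$, $|\bm n|=n_1+\dots+n_r$; $\bm e_i$ is the $r$-tuple whose only nonzero entry, equal to $1$, is in position $i$. Type II Jacobi–Piñeiro polynomial $P^{(\bm\alpha;\beta)}_{\bm n}$: the monic polynomial of degree $|\bm n|$ with $\int_0^1P^{(\bm\alpha;\beta)}_{\bm n}(x)x^{\alpha_j+k}(1-x)^\beta dx=0$ for $0\le k\le n_j-1$, $j=1,\dots,r$. Interlacing: let $p$ be real-rooted of degree $N$ with zeros $\lambda_1(p)\le\dots\le\lambda_N(p)$ and $q$ real-rooted of degree $M$ with zeros $\lambda_1(q)\le\dots\le\lambda_M(q)$. Then $p\preccurlyeq q$ means that either $M=N$ and $\lambda_1(p)\le\lambda_1(q)\le\lambda_2(p)\le\lambda_2(q)\le\dots\le\lambda_N(p)\le\lambda_N(q)$, or $M=N-1$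 and $\lambda_1(p)\le\lambda_1(q)\le\lambda_2(p)\le\dots\le\lambda_{N-1}(p)\le\lambda_{N-1}(q)\le\lambda_N(p)$. *)

(* Defs.v *)
From HB Require Import structures.
From mathcomp Require Import all_boot all_order all_algebra.
From mathcomp Require Import all_classical all_reals all_analysis.

Set Implicit Arguments.
Unset Strict Implicit.
Unset Printing Implicit Defensive.

Import Order.TTheory GRing.Theory Num.Theory.

Local Open Scope classical_set_scope.
Local Open Scope ring_scope.

(* An r-tuple of parameters or of indices is a row vector, so that the tuple
   e_i is [delta_mx 0 i]. *)

(* The integral is extended-real-valued: it can only be 0 if the integrand is
   integrable, which is automatic when all the entries of [alpha] are > -1. The
   value at x = 0 of [x `^ a] is irrelevant. *)
Definition is_jacobi_pineiro (R : realType) (r : nat) (alpha : 'rV[R]_r)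
    (beta : nat) (n : 'rV[nat]_r) (p : {poly R}) : Prop :=
  [/\ p \is monic,
      size p = (\sum_(j < r) n 0%R j).+1%N
    & forall (j : 'I_r) (k : nat), (k < n 0%R j)%N ->
        (\int[lebesgue_measure]_(x in `[0%R, 1%R])
            (p.[x] * x `^ (alpha 0 j + k%:R) * (1 - x) ^+ beta)%:E = 0)%E].

(* If no polynomial qualified this would be the zero polynomial, which is in
   relation [interlaces] with nothing. *)
Definition jacobi_pineiro (R : realType) (r : nat) (alpha : 'rV[R]_r)
    (beta : nat) (n : 'rV[nat]_r) : {poly R} :=
  xget 0 [set p | is_jacobi_pineiro alpha beta n p].

(* [p] is nonzero and real-rooted, and [s] lists its zeros with multiplicity in
   nondecreasing order; in particular [size s] is the degree of [p]. *)
Definition ordered_zeros (R : realType) (p : {poly R}) (s : seq R) : Prop :=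
  [/\ p != 0, sorted <=%R s
    & p = lead_coef p *: \prod_(z <- s) ('X - z%:P)].

(* Indices start at 0, so [s`_k] is the (k+1)-st smallest zero. *)
Definition interlaces (R : realType) (p q : {poly R}) : Prop :=
  exists s u : seq R,
    [/\ ordered_zeros p s, ordered_zeros q u
      & [/\ size u = size s,
            forall k, (k < size s)%N -> s`_k <= u`_k
          & forall k, (k.+1 < size s)%N -> u`_k <= s`_k.+1]
        \/
        (size s = (size u).+1 /\
         forall k, (k < size u)%N -> s`_k <= u`_k <= s`_k.+1)].

(* Main.v *)
Require Import Defs.
From HB Require Import structures.
From mathcomp Require Import all_boot all_order all_algebra ring lra.
From mathcomp Require Import all_classical all_reals all_analysis.
From mathcomp Require Import measurable_realfun.

(** The coefficient multiplier by [k + b] is the Euler operator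
    [T_b F = b F + x F'].  With [A] the multiset of all [alpha_j + 1 + m],
    [m < n_j], the Rodrigues formula says that [(1 - x)^beta P_n] is
    proportional to the image of [(1 - x)^(|n| + beta)] under the product of
    the [T_b], [b] in [A].  Indeed the moment of order [b - 1] of [F] vanishes
    iff [F = T_b G] with [G(1) = 0], so that the orthogonality conditions can be
    solved one after the other; each of them raises the multiplicity at [1].

    By Rolle's theorem applied to [x^b F], the operator [T_b], [b > 0], creates
    one more sign change in [(0, 1)] whenever [F(1) = 0].  If two polynomials of
    degree at most [k + 1] are such that each of their nontrivial linear
    combinations has [k] sign changes, then no combination has a double root,
    their Wronskian has a constant sign, and their zeros interlace, in an order
    read off from the Wronskian at [0].  This property of a pencil is preserved
    by the operators [T_b].  It is immediate when two multisets differ by one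
    element [b], which yields the first interlacing and also shows that the
    zeros increase with the elements of [A].  For the shift of [alpha_i] by [2]
    it follows from a contiguous relation between the Jacobi polynomials of
    parameters [a], [a + 1] and [a + 2].  For [0 <= t <= 2] the zeros are then
    squeezed: [z_k(0) <= z_k(t) <= z_k(2) < z_(k+1)(0)]. *)

Set Implicit Arguments.
Unset Strict Implicit.
Unset Printing Implicit Defensive.

Import Order.TTheory GRing.Theory Num.Theory.
Import numFieldNormedType.Exports.
Local Open Scope ring_scope.

(** * Coefficient multipliers and Rodrigues polynomials *)

Section Multipliers.
Variable R : realFieldType.
Implicit Types (F G H h phi psi : {poly R}) (b c : R) (A B : seq R).

(** This is [phi(x d/dx)], since [x d/dx] multiplies [x^k] by [k]. Products of the polynomials [phi]
    become compositions, so all these operators commute. *)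
Definition multiplier phi F : {poly R} :=
  \poly_(k < size F) (phi.[k%:R] * F`_k).

Lemma coef_multiplier phi F k :
  (multiplier phi F)`_k = phi.[k%:R] * F`_k.
Proof.
rewrite coef_poly; case: ltnP => // le_Fk.
by rewrite (nth_default 0 le_Fk) mulr0.
Qed.

Lemma multiplierM phi psi F :
  multiplier (phi * psi) F = multiplier phi (multiplier psi F).
Proof. by apply/polyP => k; rewrite !coef_multiplier hornerM mulrA. Qed.

Lemma multiplier1 F : multiplier 1 F = F.
Proof. by apply/polyP => k; rewrite coef_multiplier hornerC mul1r. Qed.

Lemma multiplierDr phi F G :
  multiplier phi (F + G) = multiplier phi F + multiplier phi G.
Proof. by apply/polyP => k; rewrite !(coefD, coef_multiplier) mulrDr. Qed.

Lemma multiplierZr phi c F : multiplier phi (c *: F) = c *: multiplier phi F.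
Proof. by apply/polyP => k; rewrite !(coefZ, coef_multiplier) mulrCA. Qed.

Lemma multiplier_linearr phi F G (u v : R) :
  multiplier phi (u *: F + v *: G) =
  u *: multiplier phi F + v *: multiplier phi G.
Proof. by rewrite multiplierDr !multiplierZr. Qed.

Lemma multiplierDl phi psi F :
  multiplier (phi + psi) F = multiplier phi F + multiplier psi F.
Proof.
by apply/polyP => k; rewrite !(coefD, coef_multiplier) hornerD mulrDl.
Qed.

Lemma multiplierZl phi c F : multiplier (c *: phi) F = c *: multiplier phi F.
Proof. by apply/polyP => k; rewrite !(coefZ, coef_multiplier) hornerZ mulrA. Qed.

Lemma hornerXD b x : ('X + b%:P).[x] = x + b.
Proof. by rewrite hornerD hornerX hornerC. Qed.

Lemma multiplier_euler b F :
  multiplier ('X + b%:P) F = b *: F + 'X * F^`().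
Proof.
apply/polyP => k; rewrite coef_multiplier coefD coefZ coefXM coef_deriv.
rewrite hornerXD; case: k => [|k] /=; first by rewrite add0r addr0.
by rewrite mulrDl addrC mulr_natl.
Qed.

Lemma multiplier_euler_factor b m h :
  multiplier ('X + b%:P) ((1 - 'X) ^+ m.+1 * h) =
  (1 - 'X) ^+ m *
    ((1 - 'X) * (b *: h + 'X * h^`()) - m.+1%:R *: ('X * h)).
Proof.
rewrite multiplier_euler derivM deriv_exp /= derivB derivX -(polyC1 R) derivC.
by rewrite -!mul_polyC polyCMn exprS -mulr_natr -polyC_natr -mulr_natl; ring.
Qed.

(** * Zeros at 1 and moments *)

Lemma dvdp_1subX F : ((1 - 'X) %| F) = root F 1.
Proof. by rewrite -opprB dvdpNl -(polyC1 R) dvdp_XsubCl. Qed.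

(** If [F = (1 - x)^(m+1) h], then [T_b F] is [(1 - x)^m] times a polynomial with value
    [-(m+1) h(1)] at 1: a positive multiplicity at 1 drops by exactly one. The condition [F(1) = 0]
    starts the induction. *)
Lemma dvdp_1subX_multiplier_euler b m F :
  0 < b -> F.[1] = 0 ->
  (1 - 'X) ^+ m %| multiplier ('X + b%:P) F -> (1 - 'X) ^+ m.+1 %| F.
Proof.
move=> b_gt0 F1; elim: m => [_|m IHm dvd_m].
  by rewrite expr1 dvdp_1subX; apply/rootP.
have /IHm : (1 - 'X) ^+ m %| multiplier ('X + b%:P) F.
  by apply: dvdp_trans dvd_m; rewrite exprS dvdp_mull.
case/dvdpP=> h defF; move: dvd_m.
have nz_m : (1 - 'X) ^+ m != 0 :> {poly R}.
  by rewrite expf_neq0 // -size_poly_gt0 -opprB size_polyN -(polyC1 R) size_XsubC.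
rewrite defF mulrC multiplier_euler_factor exprSr dvdp_mul2l //.
rewrite dvdp_1subX /root hornerD hornerN hornerZ !hornerM !hornerE.
rewrite subrr mul0r sub0r oppr_eq0 /= mulr1 mulf_eq0 (pnatr_eq0 R m.+1) /=.
move=> h1; rewrite [_ ^+ m.+2]exprSr exprSr dvdp_mul ?dvdp_1subX //.
Qed.

(* [moment b F] is the integral of [x ^ (b - 1) * F] over [0, 1]. *)
Definition moment b F : R := \sum_(k < size F) F`_k / (b + k%:R).

(** The inverse of [T_b] for [b > 0]: it is [x^(-b)] times the integral of [s^(b-1) F(s)] over
    [[0, x]], whence its value at 1 is the moment. *)
Definition antieuler b F : {poly R} := \poly_(k < size F) (F`_k / (b + k%:R)).

Lemma coef_antieuler b F k : (antieuler b F)`_k = F`_k / (b + k%:R).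
Proof.
rewrite coef_poly; case: ltnP => // le_Fk.
by rewrite (nth_default 0 le_Fk) mul0r.
Qed.

Lemma momentE b F : moment b F = (antieuler b F).[1].
Proof. by rewrite horner_poly; apply: eq_bigr => k _; rewrite expr1n mulr1. Qed.

Lemma gt0_addnat_neq0 b k : 0 < b -> b + k%:R != 0.
Proof. by move=> b_gt0; rewrite gt_eqF // ltr_wpDr. Qed.

Lemma antieulerK b F : 0 < b -> multiplier ('X + b%:P) (antieuler b F) = F.
Proof.
move=> b_gt0; apply/polyP => k; rewrite coef_multiplier coef_antieuler hornerXD.
by rewrite addrC mulrC divfK ?gt0_addnat_neq0.
Qed.

Lemma multiplier_eulerK b F :
  0 < b -> antieuler b (multiplier ('X + b%:P) F) = F.
Proof.
move=> b_gt0; apply/polyP => k; rewrite coef_antieuler coef_multiplier hornerXD.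
by rewrite addrC mulrC mulKf ?gt0_addnat_neq0.
Qed.

(** Integration by parts, done algebraically through [T_b = T_c + (b - c)]. *)
Lemma moment_multiplier_euler b c F : 0 < c ->
  moment c (multiplier ('X + b%:P) F) = F.[1] + (b - c) * moment c F.
Proof.
move=> c_gt0; rewrite !momentE.
have -> : 'X + b%:P = ('X + c%:P) + (b - c)%:P :> {poly R} by rewrite polyCB; ring.
rewrite multiplierDl -(mulr1 (b - c)%:P) mul_polyC multiplierZl multiplier1.
have -> : antieuler c (multiplier ('X + c%:P) F + (b - c) *: F) =
    F + (b - c) *: antieuler c F.
  rewrite -{3}(multiplier_eulerK F c_gt0); apply/polyP => k.
  by rewrite !(coefD, coefZ, coef_antieuler) mulrDl mulrA.
by rewrite hornerD hornerZ.
Qed.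

(** * Products of Euler operators and Rodrigues polynomials *)

Definition prodXD A : {poly R} := \prod_(b <- A) ('X + b%:P).

Lemma prodXD_cons b A : prodXD (b :: A) = ('X + b%:P) * prodXD A.
Proof. by rewrite /prodXD big_cons. Qed.

Lemma prodXD_cat A B : prodXD (A ++ B) = prodXD A * prodXD B.
Proof. by rewrite /prodXD big_cat. Qed.

Lemma prodXD_nat_gt0 A (k : nat) :
  {in A, forall b, 0 < b} -> 0 < (prodXD A).[k%:R].
Proof.
move=> A_gt0; rewrite /prodXD big_seq horner_prod prodr_gt0 // => b /A_gt0 b_gt0.
by rewrite hornerXD ltr_wpDl.
Qed.

Lemma multiplier_prodXD_dvd A m F :
  (1 - 'X) ^+ (m + size A) %| F -> (1 - 'X) ^+ m %| multiplier (prodXD A) F.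
Proof.
elim: A m => [|b A IHA] m; first by rewrite addn0 /prodXD big_nil multiplier1.
rewrite prodXD_cons multiplierM /= -addSnnS => /IHA /dvdpP[h ->].
by rewrite mulrC multiplier_euler_factor dvdp_mulr.
Qed.

(* Each vanishing moment is used to write [F] as the image of [G] under the
   Euler operator, with [G.[1] = 0]; the other moments of [G] still vanish
   because the elements of [A] are distinct. *)
Lemma moments_eq0 A m F :
  uniq A -> {in A, forall b, 0 < b} -> (1 - 'X) ^+ m %| F ->
  {in A, forall b, moment b F = 0} ->
  exists H, [/\ F = multiplier (prodXD A) H, (1 - 'X) ^+ (m + size A) %| H
              & (size H <= size F)%N].
Proof.
elim: A m F => [|b A IHA] m F /=.
  by move=> _ _ dvdF _; exists F; rewrite /prodXD big_nil multiplier1 addn0.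
case/andP=> bA uniqA A_gt0 dvdF momF.
have b_gt0 : 0 < b by rewrite A_gt0 ?mem_head.
set G := antieuler b F.
have defF : multiplier ('X + b%:P) G = F := antieulerK F b_gt0.
have G1 : G.[1] = 0 by rewrite -momentE momF ?mem_head.
have dvdG : (1 - 'X) ^+ m.+1 %| G.
  by apply: dvdp_1subX_multiplier_euler b_gt0 G1 _; rewrite defF.
have [c cA|c cA|H [defG dvdH leHG]] := IHA _ _ uniqA _ dvdG.
- by rewrite A_gt0 // in_cons cA orbT.
- have c_gt0 : 0 < c by rewrite A_gt0 // in_cons cA orbT.
  have : moment c F = 0 by rewrite momF // in_cons cA orbT.
  rewrite -defF moment_multiplier_euler // G1 add0r => /eqP.
  rewrite mulf_eq0 subr_eq0 => /predU1P[eq_bc|/eqP//].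
  by rewrite eq_bc cA in bA.
exists H; rewrite prodXD_cons multiplierM -defG defF -addSnnS; split => //.
exact: leq_trans leHG (size_poly _ _).
Qed.

(** Each of the [size A] operators may remove one factor [1 - x]; the exponent is chosen so that
    [(1 - x)^beta] survives. *)
Definition rodrigues (beta : nat) A : {poly R} :=
  multiplier (prodXD A) ((1 - 'X) ^+ (size A + beta)).

Lemma perm_rodrigues beta A B :
  perm_eq A B -> rodrigues beta A = rodrigues beta B.
Proof.
move=> eqAB; rewrite /rodrigues (perm_size eqAB); congr multiplier.
exact: perm_big.
Qed.

Lemma dvdp_rodrigues beta A : (1 - 'X) ^+ beta %| rodrigues beta A.
Proof. by rewrite multiplier_prodXD_dvd // addnC. Qed.

(** As the operators commute, [T_b] can be applied last; the moment is then the value at 1 of its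
    argument, which still has a factor [1 - x]. *)
Lemma moment_rodrigues beta A b :
  {in A, forall b, 0 < b} -> b \in A -> moment b (rodrigues beta A) = 0.
Proof.
move=> A_gt0 bA; have b_gt0 := A_gt0 _ bA.
rewrite (perm_rodrigues _ (perm_to_rem bA)) /rodrigues prodXD_cons multiplierM.
rewrite moment_multiplier_euler // subrr mul0r addr0; apply/rootP.
rewrite -dvdp_1subX -[1 - 'X]expr1 multiplier_prodXD_dvd // dvdp_exp2l //.
by rewrite add1n leq_addr.
Qed.

Lemma size_1subX_exp n : size ((1 - 'X : {poly R}) ^+ n) = n.+1.
Proof.
by rewrite -opprB exprNn -signr_odd size_Msign -(polyC1 R) size_exp_XsubC.
Qed.

Lemma size_rodrigues beta A :
  {in A, forall b, 0 < b} -> size (rodrigues beta A) = (size A + beta).+1.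
Proof.
move=> A_gt0; rewrite -[RHS]size_1subX_exp size_poly_eq //.
rewrite mulf_neq0 //; first by rewrite gt_eqF ?prodXD_nat_gt0.
by rewrite -lead_coefE lead_coef_eq0 -size_poly_eq0 size_1subX_exp.
Qed.

(** For [A] the exponents attached to [alpha] and [n], this is the Jacobi-Piñeiro polynomial up to a
    constant factor. *)
Definition rodrigues_core beta A : {poly R} :=
  rodrigues beta A %/ (1 - 'X) ^+ beta.

Lemma rodriguesE beta A :
  rodrigues beta A = (1 - 'X) ^+ beta * rodrigues_core beta A.
Proof. by rewrite mulrC divpK ?dvdp_rodrigues. Qed.

Lemma size_rodrigues_core beta A :
  {in A, forall b, 0 < b} -> size (rodrigues_core beta A) = (size A).+1.
Proof.
move=> A_gt0; rewrite size_divp -?size_poly_eq0 size_1subX_exp //.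
by rewrite size_rodrigues //= subSn ?leq_addl // addnK.
Qed.

Lemma rodrigues_cat beta A B : rodrigues beta (A ++ B) =
  multiplier (prodXD B) (rodrigues (size B + beta) A).
Proof.
by rewrite /rodrigues prodXD_cat mulrC multiplierM size_cat addnA.
Qed.

Lemma perm_rodrigues_core beta A B :
  perm_eq A B -> rodrigues_core beta A = rodrigues_core beta B.
Proof. by move=> eqAB; rewrite /rodrigues_core (perm_rodrigues _ eqAB). Qed.

Lemma exp_1subX_neq0 n : (1 - 'X) ^+ n != 0 :> {poly R}.
Proof. by rewrite -size_poly_eq0 size_1subX_exp. Qed.

Lemma exp_1subX_gt0 n (x : R) : 0 < x < 1 -> 0 < ((1 - 'X) ^+ n : {poly R}).[x].
Proof.
move=> /andP[_ x_lt1]; rewrite horner_exp hornerD hornerN hornerX hornerC.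
by rewrite exprn_gt0 // subr_gt0.
Qed.

Lemma coef0_1subX_exp n : ((1 - 'X : {poly R}) ^+ n)`_0 = 1.
Proof. by rewrite -horner_coef0 horner_exp !hornerE subr0 expr1n. Qed.

Lemma coef1_1subX_exp n : ((1 - 'X : {poly R}) ^+ n)`_1 = - n%:R.
Proof.
have := coef_deriv ((1 - 'X : {poly R}) ^+ n) 0; rewrite mulr1n => <-.
rewrite -horner_coef0 deriv_exp derivB derivX -(polyC1 R) derivC.
by rewrite sub0r mulN1r hornerMn hornerN horner_coef0 coef0_1subX_exp mulNrn.
Qed.

(** The two lowest coefficients, found by comparing coefficients in [rodriguesE], determine the
    Wronskian of two cores at 0. *)
Lemma coef0_rodrigues_core beta A : (rodrigues_core beta A)`_0 = (prodXD A).[0].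
Proof.
have := coef0M ((1 - 'X) ^+ beta) (rodrigues_core beta A).
rewrite -rodriguesE coef_multiplier !coef0_1subX_exp mulr1 mul1r.
by rewrite mulr0n.
Qed.

Lemma coef1_rodrigues_core beta A : (rodrigues_core beta A)`_1 =
  beta%:R * (prodXD A).[0] - (size A + beta)%:R * (prodXD A).[1].
Proof.
have := coefM ((1 - 'X) ^+ beta) (rodrigues_core beta A) 1.
rewrite -rodriguesE coef_multiplier 2!big_ord_recl big_ord0 /=.
rewrite !coef0_1subX_exp !coef1_1subX_exp coef0_rodrigues_core.
rewrite mul1r addr0 subn0 => E.
rewrite -[LHS](addrK (- beta%:R * (prodXD A).[0])) -E; ring.
Qed.

(** Coefficientwise form of the equation [(1 - x) V' = - M V] satisfied by [V = (1 - x)^M]. *)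
Lemma coef_1subX_exp_rec M k :
  k.+1%:R * ((1 - 'X : {poly R}) ^+ M)`_k.+1 =
  (k%:R - M%:R) * ((1 - 'X : {poly R}) ^+ M)`_k.
Proof.
set V := (1 - 'X) ^+ M.
have dV : (1 - 'X) * V^`() = - M%:R *: V.
  rewrite deriv_exp derivB derivX -(polyC1 R) derivC sub0r /V -mul_polyC.
  case: M {V} => [|M]; first by rewrite mulr0n mulr0 oppr0 mul0r.
  by rewrite /= exprS polyCN polyC_natr -mulr_natr; ring.
have := congr1 (fun p : {poly R} => p`_k) dV.
rewrite mulrBl mul1r coefB coefXM coefZ !coef_deriv.
case: k => [|k] /= E; first by rewrite subr0 in E; rewrite sub0r -E mulr_natl.
rewrite mulrBl -mulNr -E !mulr_natl; ring.
Qed.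

(** * Arithmetic progressions of exponents and the contiguous relation *)

Definition block a n : seq R := [seq a + m%:R | m <- iota 0 n].

Lemma size_block a n : size (block a n) = n.
Proof. by rewrite size_map size_iota. Qed.

Lemma block_gt0 a n : 0 < a -> {in block a n, forall b, 0 < b}.
Proof. by move=> a_gt0 _ /mapP[m _ ->]; rewrite ltr_wpDr. Qed.

Lemma blockS a n : block a n.+1 = a :: block (a + 1) n.
Proof.
rewrite /block /= addr0; congr cons; rewrite -[1%N]addn0 iotaDl -map_comp.
by apply: eq_map => m /=; rewrite natrD addrA.
Qed.

Lemma perm_blockSr a n : perm_eq (block a n.+1) ((a + n%:R) :: block a n).
Proof. by rewrite /block -addn1 iotaD map_cat /= add0n cats1 perm_rcons. Qed.

Lemma prodXD_blockSr a n :
  prodXD (block a n.+1) = ('X + (a + n%:R)%:P) * prodXD (block a n).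
Proof. by rewrite -prodXD_cons; apply: perm_big (perm_blockSr a n). Qed.

Lemma horner_prodXD_shift A x :
  (prodXD [seq a + 1 | a <- A]).[x] = (prodXD A).[x + 1].
Proof.
rewrite /prodXD big_map !horner_prod; apply: eq_bigr => a _.
by rewrite !hornerXD addrAC addrA.
Qed.

Lemma block_shift a n : block (a + 1) n = [seq b + 1 | b <- block a n].
Proof. by rewrite -map_comp; apply: eq_map => m /=; rewrite addrAC. Qed.

Lemma all2_le_block a b n :
  a <= b -> all2 <=%R (block a n) (block b n).
Proof.
by move=> le_ab; rewrite /block; elim: (iota 0 n) => //= m s ->; rewrite lerD2r le_ab.
Qed.

(** Both sides equal [a (a + 1) ... (a + n)]. *)
Lemma prodXD_block1 a n :
  a * (prodXD (block a n)).[1] = (a + n%:R) * (prodXD (block a n)).[0].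
Proof.
case: n => [|n]; first by rewrite /block /prodXD big_nil !hornerC addr0.
rewrite {1}prodXD_blockSr blockS prodXD_cons !hornerM !hornerXD block_shift.
by rewrite horner_prodXD_shift !add0r -natr1; ring.
Qed.

(** The ratio of the values at 1 and at 0 is [1 + (n + 1) / a], which decreases in [a]. This will
    give the sign of Wronskians at 0. *)
Lemma prodXD_block_ratio_lt a b n : 0 < a -> a < b ->
  (prodXD (block a n.+1)).[0] * (prodXD (block b n.+1)).[1] <
  (prodXD (block a n.+1)).[1] * (prodXD (block b n.+1)).[0].
Proof.
move=> a_gt0 lt_ab; have b_gt0 := lt_trans a_gt0 lt_ab.
have Ea := prodXD_block1 a n.+1; have Eb := prodXD_block1 b n.+1.
have a0 := prodXD_nat_gt0 0 (block_gt0 (n := n.+1) a_gt0).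
have b0 := prodXD_nat_gt0 0 (block_gt0 (n := n.+1) b_gt0).
rewrite -(ltr_pM2l a_gt0) -(ltr_pM2l b_gt0) -subr_gt0.
rewrite !mulr0n in a0 b0.
move: Ea Eb a0 b0; set p0 := (prodXD (block a _)).[0].
set p1 := (prodXD _).[1]; set q0 := (prodXD (block b _)).[0].
set q1 := (prodXD _).[1] => Ea Eb p0_gt0 q0_gt0.
have -> : b * (a * (p1 * q0)) - b * (a * (p0 * q1)) =
    b * q0 * (a * p1) - a * p0 * (b * q1) by ring.
have -> : b * q0 * (a * p1) - a * p0 * (b * q1) =
    n.+1%:R * (b - a) * (p0 * q0) by rewrite Ea Eb; ring.
by rewrite !mulr_gt0 ?ltr0n // subr_gt0.
Qed.

(** The multiplier of [x^k] in [J b] is the Pochhammer symbol [(b + k)_(n+1)]. In the coefficient of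
    [x^(k+1)] all these symbols share the factor [(a + k + 2)_n], and the recurrence for the
    coefficients of [(1 - x)^M] settles the rest. *)
Lemma block_contiguous a n M :
  let J b := multiplier (prodXD (block b n.+1)) ((1 - 'X) ^+ M) in
  (a + M%:R + 1) *: ('X * J (a + 2)) =
  ((a + M%:R + 1 + n.+1%:R) *: 'X + a%:P) * J (a + 1) - (a + n.+1%:R) *: J a.
Proof.
move=> J; have addr2 : a + 2 = a + 1 + 1 by ring.
apply/polyP => k; rewrite mulrDl mul_polyC -scalerAl.
rewrite !(coefB, coefD, coefZ, coefXM, coef_multiplier).
case: k => [|k] /=.
  rewrite mulr0 mulr0 add0r.
  rewrite prodXD_blockSr blockS prodXD_cons !hornerM !hornerXD -natr1; ring.
rewrite addr2 [block (a + 1 + 1) _]block_shift horner_prodXD_shift natr1.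
have -> : (prodXD (block (a + 1) n.+1)).[k%:R] =
    (a + k.+1%:R) * (prodXD (block (a + 1) n)).[k.+1%:R].
  rewrite blockS prodXD_cons hornerM hornerXD.
  rewrite block_shift horner_prodXD_shift natr1.
  by rewrite -natr1; ring.
have -> : (prodXD (block (a + 1) n.+1)).[k.+1%:R] =
    (a + k.+1%:R + n.+1%:R) * (prodXD (block (a + 1) n)).[k.+1%:R].
  by rewrite prodXD_blockSr hornerM hornerXD -[n.+1%:R]natr1; ring.
have -> : (prodXD (block a n.+1)).[k.+1%:R] =
    (a + k.+1%:R) * (prodXD (block (a + 1) n)).[k.+1%:R].
  by rewrite blockS prodXD_cons hornerM hornerXD; ring.
have := coef_1subX_exp_rec M k; set V := (1 - 'X) ^+ M => E.
(* After multiplication by [k + 1], the next coefficient of [V] occurs only in the product that [E]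
   rewrites. *)
apply: (mulfI (_ : k.+1%:R != 0)); first by rewrite pnatr_eq0.
set Y := (prodXD _).[_].
rewrite [RHS](_ : _ =
  k.+1%:R * (a + M%:R + 1 + n.+1%:R) * (a + k.+1%:R) * Y * V`_k -
  n.+1%:R * k.+1%:R * Y * (k.+1%:R * V`_k.+1)); last by ring.
by rewrite E -[k.+1%:R]natr1; ring.
Qed.

(** The two lowest coefficients, [q] and [- (M + 1) (p + q)], determine [p] and [q]. *)
Lemma multiplier_linear_1subX_neq0 (p q : R) M : (p != 0) || (q != 0) ->
  multiplier (p *: 'X + q%:P) ((1 - 'X) ^+ M.+1) != 0.
Proof.
apply: contraTneq => E0.
have q0 : q = 0.
  have := congr1 (fun f : {poly R} => f`_0) E0.
  rewrite coef0 coef_multiplier coef0_1subX_exp mulr1.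
  by rewrite hornerD hornerZ hornerX hornerC mulr0 add0r.
have := congr1 (fun f : {poly R} => f`_1) E0.
rewrite coef0 coef_multiplier coef1_1subX_exp hornerD hornerZ hornerX hornerC.
move/eqP; rewrite q0 addr0 !mulf_eq0 oppr_eq0 !pnatr_eq0 /= !orbF => /eqP->.
by rewrite eqxx.
Qed.

Lemma dvdp_multiplier_linear (p q : R) m :
  (1 - 'X) ^+ m %| multiplier (p *: 'X + q%:P) ((1 - 'X) ^+ m.+1).
Proof.
have -> : p *: 'X + q%:P = p *: ('X + 0%:P) + q *: 1 :> {poly R}.
  by rewrite addr0 -!mul_polyC mulr1.
rewrite multiplierDl !multiplierZl multiplier1 -[X in multiplier _ X]mulr1.
rewrite multiplier_euler_factor -!mul_polyC.
by rewrite dvdp_add // dvdp_mull ?dvdp_exp2l // dvdp_mulr.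
Qed.

End Multipliers.

(** * Sign changes and interlacing *)

Section Alternation.
Variable R : rcfType.
Implicit Types (f g h : {poly R}) (s w : seq R).

(* The factor [e] carries the sign at the first point; its modulus is
   irrelevant. *)
Definition alternates (k : nat) h : Prop :=
  exists (e : R) (y : nat -> R),
    [/\ forall i, (i <= k)%N -> 0 < y i < 1,
        forall i, (i < k)%N -> y i < y i.+1
      & forall i, (i <= k)%N -> 0 < e * (-1) ^+ i * h.[y i]].

Lemma alternatesW j k h : (j <= k)%N -> alternates k h -> alternates j h.
Proof.
move=> le_jk [e [y [y01 y_lt hy]]]; exists e, y; split=> i le_ij.
- exact/y01/(leq_trans le_ij).
- exact/y_lt/(leq_trans le_ij).
- exact/hy/(leq_trans le_ij).
Qed.

Lemma alternatesZ k (c : R) h :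
  c != 0 -> alternates k h -> alternates k (c *: h).
Proof.
move=> c_neq0 [e [y [y01 y_lt hy]]]; exists (e / c), y; split=> // i le_ik.
have -> : e / c * (-1) ^+ i * (c *: h).[y i] = e * (-1) ^+ i * h.[y i].
  by rewrite hornerZ; field.
exact: hy.
Qed.

Lemma alternates_mulr k g h : (forall x, 0 < x < 1 -> 0 < g.[x]) ->
  alternates k (g * h) <-> alternates k h.
Proof.
move=> g_gt0; split=> -[e [y [y01 y_lt hy]]]; exists e, y; split=> // i le_ik.
  by have := hy i le_ik; rewrite hornerM mulrCA pmulr_rgt0 ?g_gt0 ?y01.
by rewrite hornerM mulrCA pmulr_rgt0 ?g_gt0 ?y01 ?hy.
Qed.

(** A nonzero polynomial cannot vanish at all of [size h] distinct points; those used are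
    [1 / (2 (m + 1))], inside [(0, 1)]. *)
Lemma alternates0 h : h != 0 -> alternates 0 h.
Proof.
move=> h_neq0; pose s : seq R := [seq (m.+1%:R)^-1 / 2 | m <- iota 0 (size h)].
have : ~~ all (root h) s.
  apply/negP => /(max_poly_roots h_neq0); rewrite size_map size_iota ltnn.
  suff -> : uniq s by move=> /(_ isT).
  rewrite map_inj_uniq ?iota_uniq // => m p.
  have nz2 : (2 : R)^-1 != 0 by rewrite invr_eq0 pnatr_eq0.
  by move=> /(mulIf nz2)/invr_inj/eqP; rewrite eqr_nat => /eqP[].
case/allPn=> x /mapP[m _ ->] hx.
exists (h.[(m.+1%:R)^-1 / 2]), (fun=> (m.+1%:R)^-1 / 2).
split=> // -[|i] // _.
  rewrite divr_gt0 ?invr_gt0 ?ltr0Sn //= ltr_pdivrMr ?ltr0n // mul1r.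
  by rewrite (@le_lt_trans _ _ 1) ?ltr1n // invf_le1 ?ler1n ?ltr0Sn.
by rewrite expr0 mulr1 -expr2 lt_def sqrf_eq0 sqr_ge0 -[_ == 0]/(root _ _) hx.
Qed.

Lemma alternates_roots k h : alternates k h ->
  exists s, [/\ size s = k, sorted <%R s, {in s, forall x, 0 < x < 1}
              & all (root h) s].
Proof.
move=> [e [y [y01 y_lt hy]]].
have /choice[z zP] : forall i, exists x,
    (i < k)%N -> y i < x < y i.+1 /\ root h x.
  move=> i; case: (ltnP i k) => [lt_ik|_]; last by exists 0.
  have h1 := hy i (ltnW lt_ik); have h2 := hy i.+1 lt_ik.
  (* This factor makes [c h] negative at [y i] and positive at the next point. *)
  set c := - (e * (-1) ^+ i).
  have c_neq0 : c != 0.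
    by apply: contraTneq h1 => /eqP; rewrite oppr_eq0 => /eqP->; rewrite mul0r ltxx.
  have c1 : (c *: h).[y i] < 0 by rewrite hornerZ mulNr oppr_lt0.
  have c2 : 0 < (c *: h).[y i.+1].
    by rewrite hornerZ /c -mulrN -mulN1r -exprS.
  have [|x /andP[le1 le2] rx] := @poly_ivt _ (c *: h) _ _ (ltW (y_lt i lt_ik)).
    by rewrite (ltW c1) (ltW c2).
  exists x => _; rewrite rootZ // in rx; rewrite !lt_def le1 le2 !andbT rx.
  have rcx : (c *: h).[x] = 0 by rewrite hornerZ (rootP rx) mulr0.
  split=> //; apply/andP; split.
    by apply: contraTneq c1 => <-; rewrite rcx ltxx.
  by apply: contraTneq c2 => ->; rewrite rcx ltxx.
exists (mkseq z k); rewrite size_mkseq; split=> //.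
- apply/(sortedP 0) => i; rewrite size_mkseq => lt_ik.
  rewrite !nth_mkseq // 1?ltnW //.
  have [/andP[_ lt1] _] := zP i (ltnW lt_ik); have [/andP[lt2 _] _] := zP _ lt_ik.
  exact: lt_trans lt1 lt2.
- move=> _ /mapP[i + ->]; rewrite mem_iota => /= lt_ik.
  have [/andP[lt1 lt2] _] := zP i lt_ik.
  have /andP[gt0 _] := y01 i (ltnW lt_ik); have /andP[_ lt1'] := y01 _ lt_ik.
  by rewrite (lt_trans gt0 lt1) (lt_trans lt2 lt1').
- by apply/allP => _ /mapP[i + ->]; rewrite mem_iota => /= lt_ik; case: (zP i lt_ik).
Qed.

Lemma alternates_neq0 k h : alternates k h -> h != 0.
Proof.
move=> [e [y [_ _ /(_ 0%N isT)]]]; apply: contraTneq => ->.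
by rewrite horner0 mulr0 ltxx.
Qed.

Lemma alternates_size k h : alternates k h -> (k < size h)%N.
Proof.
move=> alt_h; have [s [<- s_lt _ rs]] := alternates_roots alt_h.
by rewrite max_poly_roots ?(alternates_neq0 alt_h) // lt_sorted_uniq.
Qed.

Lemma alternates_factor k h : alternates k h -> size h = k.+1 ->
  exists s, [/\ size s = k, sorted <%R s, {in s, forall x, 0 < x < 1}
              & h = lead_coef h *: \prod_(z <- s) ('X - z%:P)].
Proof.
move=> alt_h sz_h; have [s [sz_s s_lt s01 rs]] := alternates_roots alt_h.
exists s; split=> //; apply: all_roots_prod_XsubC => //; first by rewrite sz_s.
by rewrite uniq_rootsE lt_sorted_uniq.
Qed.

(* Dividing by the square [('X - x%:P) ^+ 2] keeps the signs but lowers the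
   degree below the number of sign changes. *)
Lemma alternates_no_double_root k h x :
  alternates k h -> (size h <= k.+2)%N -> root h x -> h^`().[x] != 0.
Proof.
move=> alt_h sz_h /factor_theorem[q def_h]; apply/eqP.
rewrite def_h derivM derivXsubC hornerD !hornerM hornerXsubC subrr mulr0 add0r.
rewrite hornerC mulr1 => /eqP/factor_theorem[p def_q].
have {}def_h : h = ('X - x%:P) ^+ 2 * p by rewrite def_h def_q -mulrA mulrC expr2.
have p_neq0 : p != 0.
  by apply: contraNneq (alternates_neq0 alt_h) => p0; rewrite def_h p0 mulr0.
have/alternates_size : alternates k p.
  case: alt_h => [e [y [y01 y_lt hy]]]; exists e, y; split=> // i le_ik.
  have := hy i le_ik; rewrite def_h hornerM horner_exp hornerXsubC mulrCA.
  have [->|neq_yx] := eqVneq (y i) x; first by rewrite subrr expr0n mul0r ltxx.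
  by rewrite pmulr_rgt0 // exprn_even_gt0 //= subr_eq0.
move: sz_h; rewrite def_h size_monicM ?monic_exp ?monicXsubC //.
by rewrite size_exp_XsubC /= !ltnS leqNgt => /negP.
Qed.

(** At the zeros of [f] the combination reduces to [v g], whose signs alternate; for [v = 0] it is a
    multiple of [f]. *)
Lemma alternates_pencil_at_zeros n f g s (u v : R) :
  alternates n f -> sorted <%R s -> {in s, forall z, 0 < z < 1} ->
  size s = n.+1 -> (forall i, (i <= n)%N -> f.[s`_i] = 0) ->
  (forall i, (i <= n)%N -> 0 < (-1) ^+ i * g.[s`_i]) ->
  (u != 0) || (v != 0) -> alternates n (u *: f + v *: g).
Proof.
move=> alt_f s_lt s01 sz_s fs gs uv; have [v0|v_neq0] := eqVneq v 0.
  have u_neq0 : u != 0 by move: uv; rewrite v0 eqxx orbF.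
  by rewrite v0 scale0r addr0; apply: alternatesZ.
exists v^-1, (nth 0 s); split=> i le_in.
- by rewrite s01 // mem_nth // sz_s.
- by apply: (sortedP 0 s_lt); rewrite sz_s.
- by rewrite hornerD !hornerZ fs // mulr0 add0r mulrACA mulVf // mul1r gs.
Qed.

(** * Pencils and Wronskians *)

Definition pencil_alternates k f g : Prop :=
  forall u v : R, (u != 0) || (v != 0) -> alternates k (u *: f + v *: g).

Lemma pencil_alternates_multl k p f g : (forall x, 0 < x < 1 -> 0 < p.[x]) ->
  pencil_alternates k (p * f) (p * g) -> pencil_alternates k f g.
Proof.
move=> p_gt0 alt_fg u v uv; apply/(alternates_mulr _ _ p_gt0).
by rewrite mulrDr -!scalerAr; apply: alt_fg.
Qed.

(** With this sign convention the value at a zero of [f] is [f' g]. *)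
Definition wronskian f g : {poly R} := f^`() * g - f * g^`().

(** At a zero [x] of the Wronskian, [g(x) f - f(x) g] would have a double root; if [f] and [g] both
    vanish at [x], the combination [g'(x) f - f'(x) g] would, and [f'(x)] is not 0. *)
Lemma pencil_wronskian_neq0 k f g x : pencil_alternates k f g ->
  (size f <= k.+2)%N -> (size g <= k.+2)%N -> (wronskian f g).[x] != 0.
Proof.
move=> alt_fg sz_f sz_g; apply/negP; rewrite !hornerE => /eqP W0.
have no_double u v : (u != 0) || (v != 0) -> u * f.[x] + v * g.[x] = 0 ->
    u * f^`().[x] + v * g^`().[x] != 0.
  move=> uv h0; rewrite -!hornerZ -hornerD -!derivZ -derivD.
  apply: (@alternates_no_double_root k); first exact: alt_fg.
    rewrite (leq_trans (size_polyD _ _)) // geq_max.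
    by rewrite !(leq_trans (size_scale_leq _ _)).
  by rewrite /root hornerD !hornerZ h0.
have [/andP[/eqP fx0 /eqP gx0]|] := boolP ((f.[x] == 0) && (g.[x] == 0)).
  have := no_double 1 0; rewrite oner_neq0 fx0 gx0 !mulr0 addr0 => /(_ isT erefl).
  rewrite mul0r addr0 mul1r => f'x; have := no_double g^`().[x] (- f^`().[x]).
  rewrite oppr_eq0 f'x orbT fx0 gx0 !mulr0 addr0 mulNr mulrC subrr eqxx.
  by move=> /(_ isT erefl).
rewrite negb_and => fgx; have := no_double g.[x] (- f.[x]).
rewrite oppr_eq0 orbC => /(_ fgx); rewrite mulNr mulrC subrr => /(_ erefl).
by rewrite mulNr mulrC W0 eqxx.
Qed.

Lemma pencil_wronskian_lt0 k f g x : pencil_alternates k f g ->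
  (size f <= k.+2)%N -> (size g <= k.+2)%N ->
  (wronskian f g).[0] < 0 -> (wronskian f g).[x] < 0.
Proof.
move=> alt_fg sz_f sz_g W0; set W := wronskian f g in W0 *.
have nzW z : W.[z] != 0 := pencil_wronskian_neq0 z alt_fg sz_f sz_g.
rewrite ltNge; apply/negP => Wx; case: (leP 0 x) => [x_ge0|/ltW x_le0].
  have := @poly_ivt _ W _ _ x_ge0; rewrite Wx (ltW W0).
  by move=> /(_ isT)[z _ /rootP Wz]; have := nzW z; rewrite Wz eqxx.
have := @poly_ivt _ (- W) _ _ x_le0.
rewrite !hornerN oppr_le0 oppr_ge0 Wx (ltW W0).
move=> /(_ isT)[z _]; rewrite rootN => /rootP Wz.
by have := nzW z; rewrite Wz eqxx.
Qed.

(** * From signs at zeros to interlacing *)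

Lemma sign_prod_subr s x : x \notin s ->
  0 < (-1) ^+ count (< x) s * \prod_(z <- s) (z - x).
Proof.
elim: s => [|z s IHs]; first by rewrite big_nil mulr1.
rewrite inE negb_or big_cons /= => /andP[neq_xz /IHs].
rewrite exprD mulrACA => /pmulr_lgt0->; case: (ltgtP x z) neq_xz => //= ? _;
  by rewrite ?expr1 ?expr0 ?mulN1r ?mul1r ?opprB subr_gt0.
Qed.

(** Starting from [f(0) > 0], the sign changes once at each zero below [x]. *)
Lemma sign_horner_split s f x : {in s, forall z, 0 < z} ->
  f = lead_coef f *: \prod_(z <- s) ('X - z%:P) -> 0 < f.[0] -> x \notin s ->
  0 < (-1) ^+ count (< x) s * f.[x].
Proof.
move=> s_gt0 def_f f0 /sign_prod_subr.
have p_gt0 : 0 < \prod_(z <- s) z by rewrite big_seq prodr_gt0.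
have hP y : f.[y] = lead_coef f * (-1) ^+ size s * \prod_(z <- s) (z - y).
  rewrite {1}def_f hornerZ horner_prod -mulrA; congr (_ * _).
  elim: (s) => [|z s' IHs]; first by rewrite !big_nil mulr1.
  by rewrite !big_cons /= exprS mulrACA -IHs hornerXsubC mulN1r opprB.
have : 0 < lead_coef f * (-1) ^+ size s.
  by move: f0; rewrite hP; under eq_bigr do rewrite subr0; rewrite pmulr_lgt0.
by move=> /pmulr_rgt0 c_gt0; rewrite hP mulrCA c_gt0.
Qed.

(** At the zeros of [f] the Wronskian [f' g] is negative, while [f'] alternates in sign, starting
    with a negative value because [f(0) > 0]. *)
Lemma pencil_sign k f g s : pencil_alternates k f g ->
  (size f <= k.+2)%N -> (size g <= k.+2)%N -> (wronskian f g).[0] < 0 ->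
  0 < f.[0] -> sorted <%R s -> {in s, forall z, 0 < z} ->
  f = lead_coef f *: \prod_(z <- s) ('X - z%:P) ->
  forall i, (i < size s)%N -> 0 < (-1) ^+ i * g.[s`_i].
Proof.
move=> alt_fg sz_f sz_g W0 f0 s_lt s_gt0 def_f i lt_is.
have sis := mem_nth 0 lt_is; have uniq_s := lt_sorted_uniq s_lt.
have si_gt0 := s_gt0 _ sis.
pose s' := rem s`_i s; pose q := lead_coef f *: \prod_(z <- s') ('X - z%:P).
have fE : f = ('X - (s`_i)%:P) * q.
  by rewrite {1}def_f (perm_big _ (perm_to_rem sis)) big_cons scalerAr.
have lcq : lead_coef q = lead_coef f.
  by rewrite fE lead_coefM lead_coefXsubC mul1r.
have df : f^`().[s`_i] = q.[s`_i].
  rewrite fE derivM derivXsubC hornerD !hornerM hornerXsubC subrr mul0r.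
  by rewrite addr0 hornerC mul1r.
(* The sign is reversed because the removed factor takes the negative value [- s_i] at 0. *)
have q0 : 0 < (- q).[0].
  by move: f0; rewrite fE hornerM hornerXsubC sub0r mulNr hornerN -mulrN pmulr_rgt0.
have := @sign_horner_split s' (- q) s`_i _ _ q0.
rewrite mem_rem_uniqF // lead_coefN lcq scaleNr => /(_ _ _ isT).
have -> : count (< s`_i) s' = i.
  have := count_lt_nth 0 s_lt lt_is.
  by rewrite (permP (perm_to_rem sis)) /= ltxx.
have := pencil_wronskian_lt0 s`_i alt_fg sz_f sz_g W0.
have fs : f.[s`_i] = 0 by rewrite fE hornerM hornerXsubC subrr mul0r.
rewrite hornerD hornerN !hornerM fs mul0r subr0 df hornerN => W_lt0 sgn_q.
have {}sgn_q : 0 < (-1) ^+ i * - q.[s`_i].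
  by apply: sgn_q => // z /mem_rem /s_gt0.
have := mulr_gt0 sgn_q (_ : 0 < - (q.[s`_i] * g.[s`_i])).
rewrite oppr_gt0 => /(_ W_lt0); set Q := q.[_]; set G := g.[_]; set e := _ ^+ i.
rewrite (_ : _ * _ * _ = (- Q) ^+ 2 * (e * G)); last by ring.
rewrite pmulr_rgt0 // exprn_even_gt0 //= oppr_eq0.
by apply: contraTneq W_lt0 => Q0; rewrite -/Q Q0 mul0r ltxx.
Qed.

Lemma sign_exp_gt0 (a b : nat) (x : R) :
  0 < (-1) ^+ a * x -> 0 < (-1) ^+ b * x -> odd a = odd b.
Proof.
rewrite -(signr_odd _ a) -(signr_odd _ b).
case: (odd a) (odd b) => [] [] //=; rewrite ?expr0 ?expr1 mul1r mulN1r oppr_gt0.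
  by move=> /lt_trans H /H; rewrite ltxx.
by move=> H /(lt_trans H); rewrite ltxx.
Qed.

(* The number of elements of [w] below [s`_i] is increasing in [i], has the
   parity of [i] and is at most [size s], so it is [i]. *)
Lemma parity_interlace s w : sorted <%R s -> sorted <%R w ->
  (size w <= size s)%N ->
  (forall i, (i < size s)%N -> odd (count (< s`_i) w) = odd i) ->
  (forall i, (i < size s)%N -> (i < size w)%N -> s`_i <= w`_i) /\
  (forall i, (i.+1 < size s)%N -> w`_i < s`_i.+1).
Proof.
move=> s_lt w_lt le_ws par; pose c i := count (< s`_i) w.
have c_lt i : (i.+1 < size s)%N -> (c i < c i.+1)%N.
  move=> lt_is; rewrite ltn_neqAle; apply/andP; split.
    apply: contra_eqN (par _ lt_is) => /eqP; rewrite /c => <-.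
    by rewrite par 1?ltnW //=; case: odd.
  apply: sub_count => x /= /lt_trans-> //; exact: (sortedP 0 s_lt).
have c_ge i : (i < size s)%N -> (i <= c i)%N.
  elim: i => // i IHi lt_is; exact: leq_ltn_trans (IHi (ltnW lt_is)) (c_lt i lt_is).
have c_le i : (i < size s)%N -> (c i <= i)%N.
  (* Downward induction, [m] counting the elements of [s] after [s_i]. At the last one, parity
     excludes the value [i + 1]. *)
  move=> lt_is; have [m def_m] : exists m, size s = (i + m).+1.
    by exists (size s - i.+1)%N; rewrite -addSn subnKC.
  elim: m i lt_is def_m => [|m IHm] i lt_is def_s.
    rewrite addn0 in def_s; have : (c i <= i.+1)%N.
      by rewrite -def_s; apply: leq_trans (count_size _ _) le_ws.
    rewrite leq_eqVlt => /predU1P[ci|//].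
    by have := par i lt_is; rewrite -/(c i) ci /=; case: odd.
  have lt_is' : (i.+1 < size s)%N by rewrite def_s addnS !ltnS leq_addr.
  rewrite -ltnS; apply: leq_trans (c_lt i lt_is') (IHm _ lt_is' _).
  by rewrite def_s addnS addSn.
have c_eq i : (i < size s)%N -> c i = i.
  by move=> lt_is; apply/eqP; rewrite eqn_leq c_le ?c_ge.
have w_le : sorted <=%R w by apply: sub_sorted w_lt => ? ? /ltW.
split=> i lt_is.
  by move=> lt_iw; rewrite nth_count_ge // -/(c i) c_eq // leqnn.
by rewrite nth_count_lt // -/(c i.+1) c_eq.
Qed.

(** The sign of [g] at [s_i] is [(-1)^i] by the pencil, and [(-1)] to the number of zeros of [g]
    below [s_i] by its factorization; so these exponents have the same parity. *)
Lemma pencil_interlace k f g s w : pencil_alternates k f g ->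
  (size f <= k.+2)%N -> (size g <= k.+2)%N -> (wronskian f g).[0] < 0 ->
  0 < f.[0] -> 0 < g.[0] ->
  sorted <%R s -> {in s, forall z, 0 < z} ->
  f = lead_coef f *: \prod_(z <- s) ('X - z%:P) ->
  sorted <%R w -> {in w, forall z, 0 < z} ->
  g = lead_coef g *: \prod_(z <- w) ('X - z%:P) ->
  (size w <= size s)%N ->
  (forall i, (i < size s)%N -> (i < size w)%N -> s`_i <= w`_i) /\
  (forall i, (i.+1 < size s)%N -> w`_i < s`_i.+1).
Proof.
move=> alt_fg sz_f sz_g W0 f0 g0 s_lt s_gt0 def_f w_lt w_gt0 def_g le_ws.
apply: parity_interlace => // i lt_is.
have sgn_g := pencil_sign alt_fg sz_f sz_g W0 f0 s_lt s_gt0 def_f lt_is.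
apply: sign_exp_gt0 (sgn_g); apply: sign_horner_split => //.
apply: contraTN sgn_g => siw; rewrite -leNgt {1}def_g hornerZ.
by rewrite (_ : _.[_] = 0) ?mulr0 //; apply/rootP; rewrite root_prod_XsubC.
Qed.

End Alternation.

(** * Rolle's theorem and moments *)

Section Analysis.
Local Open Scope classical_set_scope.
Local Open Scope ring_scope.
Variable R : realType.
Implicit Types (F : {poly R}) (b : R).

Lemma is_derive_powR_horner b F (x : R) : 0 < b -> 0 < x ->
  is_derive x 1 (fun y => y `^ b * F.[y])
    (x `^ (b - 1) * (multiplier ('X + b%:P) F).[x]).
Proof.
move=> b_gt0 x_gt0; have dx := is_derive1_powR b x_gt0.
have dF : is_derive x 1 (horner F) F^`().[x] by exact: is_derive_poly.
apply: is_derive_eq (is_deriveM dx dF) _.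
rewrite multiplier_euler hornerD hornerZ hornerM hornerX /GRing.scale /=.
by rewrite -(mulr_powRB1 (ltW x_gt0) b_gt0); ring.
Qed.

Lemma multiplier_euler_mean_value b F e x y : 0 < b -> 0 < x -> x < y ->
  0 < e * (y `^ b * F.[y] - x `^ b * F.[x]) ->
  exists2 c, x < c < y & 0 < e * (multiplier ('X + b%:P) F).[c].
Proof.
move=> b_gt0 x_gt0 lt_xy ev_gt0.
pose G z := z `^ b * F.[z].
pose dG z := z `^ (b - 1) * (multiplier ('X + b%:P) F).[z].
have GP (z : R) : x <= z -> is_derive z 1 G (dG z).
  by move=> le_xz; apply: is_derive_powR_horner (lt_le_trans x_gt0 le_xz).
have GP_oo z : z \in `]x, y[ -> is_derive z 1 G (dG z).
  by rewrite in_itv /= => /andP[/ltW/GP].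
have cG : {within `[x, y], continuous G}.
  apply: derivable_within_continuous => z; rewrite in_itv /= => /andP[/GP dGz _].
  by case: dGz.
have [c] := MVT lt_xy GP_oo cG.
rewrite in_itv /= => lt_xcy vE; exists c => //.
have {vE} vE : y `^ b * F.[y] - x `^ b * F.[x] = dG c * (y - x) := vE.
move: ev_gt0; rewrite vE mulrA pmulr_lgt0 ?subr_gt0 //.
rewrite mulrCA pmulr_rgt0 // powR_gt0 //.
by case/andP: lt_xcy => /(lt_trans x_gt0).
Qed.

(** Gives a positive point that can replace the endpoint 0 in Rolle's argument. *)
Lemma powR_horner_small b F (d y : R) : 0 < b -> 0 < d -> 0 < y ->
  exists2 x, 0 < x < y & x `^ b * `|F.[x]| < d.
Proof.
move=> b_gt0 d_gt0 y_gt0; have [B FB] := poly_disk_bound F 1.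
have B_ge0 : 0 <= B by apply: le_trans (FB 0 _); rewrite ?normr0.
have r_gt0 : 0 < d / (B + 1) by rewrite divr_gt0 // ltr_wpDl.
(* The three bounds ensure [x < y], [|F(x)| <= B] and [x^b <= d / (B + 1)]. *)
pose x := Num.min (Num.min (y / 2) 1) ((d / (B + 1)) `^ b^-1).
have x_gt0 : 0 < x by rewrite !lt_min powR_gt0 // ltr01 divr_gt0.
exists x.
  rewrite x_gt0 /x !gt_min ltr_pdivrMr // mulr_natr mulr2n ltrDl y_gt0 //.
have le_xr : x `^ b <= d / (B + 1).
  have -> : d / (B + 1) = ((d / (B + 1)) `^ b^-1) `^ b.
    by rewrite -powRrM mulVf ?gt_eqF // powRr1 ?ltW.
  apply: ge0_ler_powR; rewrite ?nnegrE ?powR_ge0 ?(ltW b_gt0) ?(ltW x_gt0) //.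
  by rewrite /x ge_min lexx orbT.
have le_FB : `|F.[x]| <= B by rewrite FB // gtr0_norm // !ge_min lexx orbT.
apply: le_lt_trans (ler_pM (powR_ge0 _ _) (normr_ge0 _) le_xr le_FB) _.
by rewrite mulrAC ltr_pdivrMr ?ltr_wpDl // ltr_pM2l // ltrDl.
Qed.

(* Rolle's theorem for [x ^ b * F], which vanishes at 0 and at 1: the points
   [z] are those of [F] together with a point close to 0 and the point 1. *)
Lemma alternates_multiplier_euler b k F : 0 < b -> F.[1] = 0 ->
  alternates k F -> alternates k.+1 (multiplier ('X + b%:P) F).
Proof.
move=> b_gt0 F1 [e [y [y01 y_lt Fy]]].
have y0_gt0 : 0 < y 0%N by case/andP: (y01 0%N isT).
pose v x := x `^ b * F.[x].
have ev_gt0 i : (i <= k)%N -> 0 < e * (-1) ^+ i * v (y i).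
  move=> le_ik; have /andP[yi_gt0 _] := y01 i le_ik.
  by rewrite mulrCA pmulr_rgt0 ?powR_gt0 ?Fy.
have e_neq0 : e != 0.
  by apply: contraTneq (Fy 0%N isT) => ->; rewrite !mul0r ltxx.
(* This quantity is the modulus of [v (y 0)]: a smaller value at the extra point cannot reverse the
   sign of the first increment. *)
have d_gt0 : 0 < e * v (y 0%N) / `|e|.
  by rewrite divr_gt0 ?normr_gt0 //; have := ev_gt0 0%N isT; rewrite mulr1.
have [x0 /andP[x0_gt0 x0_lt] x0_small] := powR_horner_small F b_gt0 d_gt0 y0_gt0.
pose z i := if i is j.+1 then if (j <= k)%N then y j else 1 else x0.
(* The [k + 3] points bound [k + 2] intervals, on which the increments of [v] alternate in sign;
   each yields one point [c i]. *)
have z_step i : (i <= k.+1)%N ->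
    [/\ 0 < z i, z i < z i.+1 & 0 < e * (-1) ^+ i * (v (z i.+1) - v (z i))].
  case: i => [|i] /=; rewrite ?ltnS => le_ik.
    split=> //; rewrite mulr1 mulrBr subr_gt0.
    rewrite ltr_pdivlMr ?normr_gt0 // in x0_small; apply: le_lt_trans x0_small.
    apply: le_trans (ler_norm _) _.
    by rewrite /v !normrM (ger0_norm (powR_ge0 _ _)) mulrC.
  rewrite le_ik; have /andP[yi_gt0 yi_lt1] := y01 i le_ik; split=> //.
    by case: ifP => // /y_lt.
  rewrite exprS mulN1r mulrN mulNr -mulrN opprB mulrBr subr_gt0.
  apply: le_lt_trans (ev_gt0 i le_ik); case: ifP => [lt_ik|_].
    have := ltW (ev_gt0 i.+1 lt_ik).
    by rewrite exprS mulN1r mulrN mulNr oppr_ge0.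
  by rewrite /v F1 !mulr0.
have /choice[c cP] : forall i, exists c, (i <= k.+1)%N ->
    z i < c < z i.+1 /\ 0 < e * (-1) ^+ i * (multiplier ('X + b%:P) F).[c].
  move=> i; case: (leqP i k.+1) => [le_ik|_]; last by exists 0.
  have [zi_gt0 lt_z v_gt0] := z_step i le_ik.
  by have [c] := multiplier_euler_mean_value b_gt0 zi_gt0 lt_z v_gt0; exists c.
exists e, c; split=> i le_ik; last by case: (cP i le_ik).
- have [zi_gt0 _ _] := z_step i le_ik; have [/andP[lt_zc lt_cz] _] := cP i le_ik.
  rewrite (lt_trans zi_gt0 lt_zc) (lt_le_trans lt_cz) //=.
  by case: leqP => // /y01 /andP[_ /ltW].
- have [/andP[_ lt_cz] _] := cP i (ltnW le_ik).
  by have [/andP[/(lt_trans lt_cz)]] := cP i.+1 le_ik.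
Qed.

(** * Integrals of powers and the orthogonality conditions *)

Lemma integral_powR_segment (a c : R) : 0 < a < 1 -> -1 < c ->
  (\int[lebesgue_measure]_(x in `[a, 1%R]) (x `^ c)%:E =
   ((1 - a `^ (c + 1)) / (c + 1))%R%:E)%E.
Proof.
move=> /andP[a_gt0 a_lt1] c_gtN1; have c1_gt0 : 0 < c + 1 by rewrite -ltrBlDr sub0r.
pose G (x : R) := (c + 1)^-1 * x `^ (c + 1).
have dG (x : R) : 0 < x -> is_derive x 1 G (x `^ c).
  move=> x_gt0; have dx := is_derive1_powR (c + 1) x_gt0.
  have dcx := is_deriveZ (c + 1)^-1 dx.
  apply: (is_derive_eq dcx).
  by rewrite /GRing.scale /= addrK mulKf ?gt_eqF.
have cG (x : R) : 0 < x -> G y @[y --> x] --> G x.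
  move=> /dG dGx; apply: differentiable_continuous.
  by apply/derivable1_diffP; case: dGx.
rewrite (@continuous_FTC2 _ (fun x => x `^ c) G) //.
- by rewrite -EFinB /G powR1 -mulrBr mulrC.
- apply: derivable_within_continuous => x; rewrite in_itv /= => /andP[ax _].
  by have [] := is_derive1_powR c (lt_le_trans a_gt0 ax).
- split; last 2 first.
  + by apply: cvg_at_right_filter; exact: cG.
  + by apply: cvg_at_left_filter; exact: cG.
  + move=> x; rewrite in_itv /= => /andP[ax _].
    by have [] := dG x (lt_trans a_gt0 ax).
- move=> x; rewrite in_itv /= => /andP[ax _]; rewrite derive1E.
  by have [_ ->] := dG x (lt_trans a_gt0 ax).
Qed.

(** For [c < 0] the integrand is unbounded near 0, so []0, 1]] is exhausted by the segments
    [[1 / (i + 2), 1]] and monotone convergence applies. *)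
Lemma integral_powR_unit (c : R) : -1 < c ->
  (\int[lebesgue_measure]_(x in `[0%R, 1%R]) (x `^ c)%:E = ((c + 1)^-1)%R%:E)%E.
Proof.
move=> c_gtN1; have c1_gt0 : 0 < c + 1 by rewrite -ltrBlDr sub0r.
have mf (D : set R) : measurable_fun D (@powR R ^~ c).
  by apply: measurable_funTS; apply: measurable_powR.
rewrite -integral_itv_obnd_cbnd; last by apply/measurable_EFinP.
pose F i : set R := `[i.+2%:R^-1, 1]%classic.
have -> : `]0, 1]%classic = \bigcup_i F i.
  apply/seteqP; split=> x /=; rewrite in_itv /=.
    move=> /andP[x_gt0 x_le1]; exists (Num.truncn x^-1) => //.
    rewrite /F /= in_itv /= x_le1 andbT invf_ple ?posrE //.
    by rewrite ltW // (lt_trans (truncnS_gt _)) ?ltr_nat.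
  case=> i _; rewrite /F /= in_itv /= => /andP[le_ix ->].
  by rewrite andbT; apply: lt_le_trans le_ix; rewrite invr_gt0 ltr0Sn.
have nnF : nondecreasing_seq F.
  apply/nondecreasing_seqP => i; rewrite subsetEset; apply: subset_itvr.
  by rewrite bnd_simp lef_pV2 ?posrE ?ltr0Sn // ler_nat.
have : (\int[lebesgue_measure]_(x in F i) (x `^ c)%:E)%E @[i --> \oo] -->
    (\int[lebesgue_measure]_(x in \bigcup_i F i) (x `^ c)%:E)%E.
  apply: ge0_nondecreasing_set_cvg_integral => //.
  - by move=> i; rewrite /F; exact: measurable_itv.
  - by move=> i; apply/measurable_EFinP; exact: mf.
  - by move=> i x _; rewrite lee_fin powR_ge0.
move=> /cvg_lim <- //.
apply: cvg_lim => //.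
under eq_fun do rewrite integral_powR_segment ?invr_gt0 ?ltr0Sn ?invf_lt1 ?ltr1n //.
have cvg0 : (i.+2%:R^-1 : R) `^ (c + 1) @[i --> \oo] --> (0 : R).
  have /cvg_at_rightP := powR_cvg0 c1_gt0; apply; split=> [i|].
    by rewrite invr_gt0 ltr0Sn.
  have := @cvg_harmonic R; rewrite -(cvg_shiftS (@harmonic R)); exact.
have cvg1 : (1 - (i.+2%:R^-1 : R) `^ (c + 1)) / (c + 1) @[i --> \oo]
    --> (1 - 0) / (c + 1).
  by apply: cvgMl; apply: cvgB; [exact: cvg_cst|exact: cvg0].
rewrite subr0 mul1r in cvg1.
by apply: cvg_EFin; [near=> i|exact: cvg1].
Unshelve. all: by end_near.
Qed.

Lemma integrable_powR_unit (c : R) : -1 < c ->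
  lebesgue_measure.-integrable `[0%R, 1%R] (fun x : R => (x `^ c)%:E).
Proof.
move=> c_gtN1; apply/integrableP; split.
  apply/measurable_EFinP; apply: measurable_funTS; exact: measurable_powR.
under eq_integral do rewrite gee0_abs ?lee_fin ?powR_ge0 //.
by rewrite integral_powR_unit // ltry.
Qed.

Lemma powRD_nat (x a : R) k : 0 <= x -> -1 < a ->
  x `^ (a + k%:R) = x `^ a * x ^+ k.
Proof.
move=> x_ge0 a_gtN1; rewrite -powR_mulrn //.
case: k => [|k]; first by rewrite addr0 powRr0 mulr1.
have ak_gt0 : 0 < a + k.+1%:R by rewrite -natr1; have := ler0n R k; lra.
by rewrite powRD // gt_eqF.
Qed.

Lemma integral_horner_powR F (a : R) : -1 < a ->
  (\int[lebesgue_measure]_(x in `[0%R, 1%R]) (F.[x] * x `^ a)%:E =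
   (moment (a + 1) F)%:E)%E.
Proof.
move=> a_gtN1.
have ak_gtN1 k : -1 < a + k%:R by rewrite ltr_wpDr.
transitivity (\int[lebesgue_measure]_(x in `[0%R, 1%R])
    \sum_(k <- index_enum 'I_(size F)) (F`_k)%:E * (x `^ (a + k%:R))%:E)%E.
  apply: eq_integral => x; rewrite inE /= in_itv /= => /andP[x_ge0 _].
  under eq_bigr do rewrite -EFinM.
  rewrite sumEFin horner_coef mulr_suml; congr EFin; apply: eq_bigr => k _.
  by rewrite powRD_nat // mulrAC mulrA.
rewrite integral_sum //; last first.
  by move=> k; apply: integrableZl => //; exact: integrable_powR_unit.
rewrite /moment -sumEFin; apply: eq_bigr => k _.
rewrite integralZl //; last exact: integrable_powR_unit.
by rewrite integral_powR_unit // -EFinM addrAC.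
Qed.

(** Turns orthogonality into algebraic conditions on coefficients. *)
Lemma is_jacobi_pineiroE (r : nat) (alpha : 'rV[R]_r) beta (n : 'rV[nat]_r) p :
  (forall j, -1 < alpha 0 j) ->
  is_jacobi_pineiro alpha beta n p <->
  [/\ p \is monic, size p = (\sum_(j < r) n 0%R j).+1
    & forall (j : 'I_r) k, (k < n 0%R j)%N ->
        moment (alpha 0 j + 1 + k%:R) ((1 - 'X) ^+ beta * p) = 0].
Proof.
move=> alpha_gtN1.
have E (j : 'I_r) k : (\int[lebesgue_measure]_(x in `[0%R, 1%R])
     (p.[x] * x `^ (alpha 0 j + k%:R) * (1 - x) ^+ beta)%:E =
   (moment (alpha 0 j + 1 + k%:R) ((1 - 'X) ^+ beta * p))%:E)%E.
  rewrite addrAC -integral_horner_powR ?ltr_wpDr //.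
  apply: eq_integral => x _; congr EFin.
  by rewrite hornerM horner_exp hornerD hornerN hornerX hornerC; ring.
split=> -[p_monic sz_p intp]; split=> // j k lt_kn.
  by have := intp j k lt_kn; rewrite E => -[].
by rewrite E intp.
Qed.

End Analysis.

(** * Zeros of Rodrigues polynomials *)

Section Zeros.
Variable R : realType.
Implicit Types (F : {poly R}) (a b : R) (A B : seq R) (beta : nat).

(** Each operator creates one sign change; the multiplicity at 1 guarantees that its argument
    vanishes there. *)
Lemma alternates_multiplier_prodXD k A F : {in A, forall b, 0 < b} ->
  (1 - 'X) ^+ size A %| F -> alternates k F ->
  alternates (k + size A) (multiplier (prodXD A) F).
Proof.
move=> A_gt0; elim: A A_gt0 => [|b A IHA] A_gt0 dvdF altF.
  by rewrite addn0 /prodXD big_nil multiplier1.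
rewrite prodXD_cons multiplierM addnS; apply: alternates_multiplier_euler.
- by rewrite A_gt0 ?mem_head.
- by apply/rootP; rewrite -dvdp_1subX -[1 - 'X]expr1 multiplier_prodXD_dvd.
- apply: IHA => // [c cA|]; first by rewrite A_gt0 // in_cons cA orbT.
  by apply: dvdp_trans dvdF; rewrite dvdp_exp2l.
Qed.

(** There are as many sign changes as the degree, so all zeros are simple and lie in [(0, 1)]. *)
Lemma alternates_rodrigues_core beta A : {in A, forall b, 0 < b} ->
  alternates (size A) (rodrigues_core beta A).
Proof.
move=> A_gt0; apply/(alternates_mulr _ _ (@exp_1subX_gt0 R beta)).
rewrite -rodriguesE -[size A]add0n; apply: alternates_multiplier_prodXD => //.
  by rewrite dvdp_exp2l ?leq_addr.
exact/alternates0/exp_1subX_neq0.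
Qed.

Definition core_zeros beta A (s : seq R) : Prop :=
  [/\ sorted <%R s, {in s, forall z, 0 < z < 1} &
      rodrigues_core beta A =
        lead_coef (rodrigues_core beta A) *: \prod_(z <- s) ('X - z%:P)].

Lemma core_zeros_exist beta A : {in A, forall b, 0 < b} ->
  exists s, core_zeros beta A s.
Proof.
move=> A_gt0.
have [s [sz_s s_lt s01 def_q]] := alternates_factor
  (alternates_rodrigues_core beta A_gt0) (size_rodrigues_core beta A_gt0).
by exists s.
Qed.

Lemma perm_core_zeros beta A B s :
  perm_eq A B -> core_zeros beta A s -> core_zeros beta B s.
Proof. by move=> eqAB [? ?]; rewrite (perm_rodrigues_core _ eqAB). Qed.

Lemma lead_rodrigues_core_neq0 beta A : {in A, forall b, 0 < b} ->
  lead_coef (rodrigues_core beta A) != 0.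
Proof.
by move=> A_gt0; rewrite lead_coef_eq0 -size_poly_eq0 size_rodrigues_core.
Qed.

Lemma size_core_zeros beta A s : {in A, forall b, 0 < b} ->
  core_zeros beta A s -> size s = size A.
Proof.
move=> A_gt0 [_ _ def_q]; apply: succn_inj.
rewrite -(size_rodrigues_core beta A_gt0) def_q size_scale ?size_prod_XsubC //.
exact: lead_rodrigues_core_neq0.
Qed.

Lemma core_zeros_inj beta A s s' : {in A, forall b, 0 < b} ->
  core_zeros beta A s -> core_zeros beta A s' -> s = s'.
Proof.
move=> A_gt0 [s_lt _ def_s] [s'_lt _ def_s']; apply: lt_sorted_eq => // x.
have nz := lead_rodrigues_core_neq0 beta A_gt0.
rewrite -!root_prod_XsubC -(rootZ _ _ nz) -def_s {1}def_s' rootZ //.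
Qed.

Lemma rodrigues_core_gt0 beta A : {in A, forall b, 0 < b} ->
  0 < (rodrigues_core beta A).[0].
Proof.
by move=> A_gt0; rewrite horner_coef0 coef0_rodrigues_core (prodXD_nat_gt0 0).
Qed.

Lemma wronskian_rodrigues_core0 beta A B :
  (wronskian (rodrigues_core beta A) (rodrigues_core beta B)).[0] =
  (size B + beta)%:R * ((prodXD A).[0] * (prodXD B).[1])
  - (size A + beta)%:R * ((prodXD A).[1] * (prodXD B).[0]).
Proof.
rewrite hornerD hornerN !hornerM !horner_coef0 !coef_deriv !mulr1n.
by rewrite !coef0_rodrigues_core !coef1_rodrigues_core -!horner_coef0; ring.
Qed.

(** The common factor [(1 - x)^beta] is positive on [(0, 1)] and does not affect alternation; the
    strict inequality says that the Wronskian of the cores is negative at 0. *)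
Lemma core_zeros_interlace k beta A B s w :
  {in A, forall b, 0 < b} -> {in B, forall b, 0 < b} ->
  (size A <= k.+1)%N -> (size B <= size A)%N ->
  (forall u v : R, (u != 0) || (v != 0) ->
     alternates k (u *: rodrigues beta A + v *: rodrigues beta B)) ->
  (size B + beta)%:R * ((prodXD A).[0] * (prodXD B).[1])
    < (size A + beta)%:R * ((prodXD A).[1] * (prodXD B).[0]) ->
  core_zeros beta A s -> core_zeros beta B w ->
  (forall i, (i < size A)%N -> (i < size B)%N -> s`_i <= w`_i) /\
  (forall i, (i.+1 < size A)%N -> w`_i < s`_i.+1).
Proof.
move=> A_gt0 B_gt0 le_Ak le_BA alt_AB W0 sP wP.
have sz_s := size_core_zeros A_gt0 sP; have sz_w := size_core_zeros B_gt0 wP.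
have [s_lt s01 def_s] := sP; have [w_lt w01 def_w] := wP.
rewrite -sz_s -sz_w.
have alt_core :
    pencil_alternates k (rodrigues_core beta A) (rodrigues_core beta B).
  apply: (pencil_alternates_multl (@exp_1subX_gt0 R beta)) => u v uv.
  by rewrite -!rodriguesE; apply: alt_AB.
apply: (pencil_interlace alt_core) => //; rewrite ?rodrigues_core_gt0 //.
- by rewrite size_rodrigues_core.
- by rewrite size_rodrigues_core // ltnS (leq_trans le_BA).
- by rewrite wronskian_rodrigues_core0 subr_lt0.
- by move=> z /s01/andP[].
- by move=> z /w01/andP[].
- by rewrite sz_s sz_w.
Qed.

(** * Changing or adding one exponent *)

Lemma rodrigues_cons_pencil_alternates beta A b c (u v : R) :
  {in A, forall a, 0 < a} -> b != c -> (u != 0) || (v != 0) ->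
  alternates (size A)
    (u *: rodrigues beta (b :: A) + v *: rodrigues beta (c :: A)).
Proof.
move=> A_gt0 neq_bc uv; set V := (1 - 'X) ^+ (size A + beta).+1 : {poly R}.
have -> : u *: rodrigues beta (b :: A) + v *: rodrigues beta (c :: A) =
    multiplier (prodXD A) (multiplier ((u + v) *: 'X + (u * b + v * c)%:P) V).
  rewrite /rodrigues !prodXD_cons /= addSn -/V -!multiplierZl -multiplierDl.
  rewrite -multiplierM; congr multiplier.
  by rewrite -!mul_polyC !polyCD !polyCM; ring.
rewrite -[size A]add0n; apply: alternates_multiplier_prodXD => //.
  apply: dvdp_trans (dvdp_multiplier_linear _ _ _).
  by rewrite dvdp_exp2l // leq_addr.
apply/alternates0/multiplier_linear_1subX_neq0.
(* As [b] and [c] differ, [u + v = 0] and [u b + v c = 0] force [u = v = 0]. *)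
rewrite -negb_and; apply: contraTN uv => /andP[/eqP uv0 /eqP ubvc0].
have def_v : v = - u by rewrite -[LHS](addKr u) uv0 addr0.
move/eqP: ubvc0; rewrite def_v mulNr -mulrBr mulf_eq0 subr_eq0 (negPf neq_bc).
by rewrite orbF => /eqP->; rewrite oppr0 eqxx.
Qed.

Lemma rodrigues_raise_pencil_alternates beta A b (u v : R) :
  {in A, forall a, 0 < a} -> 0 < b -> (u != 0) || (v != 0) ->
  alternates (size A) (u *: rodrigues beta (b :: A) + v *: rodrigues beta A).
Proof.
move=> A_gt0 b_gt0 uv; pose M := (size A + beta)%N.
pose seed : {poly R} :=
  u *: multiplier ('X + b%:P) ((1 - 'X) ^+ M.+1) + v *: (1 - 'X) ^+ M.
have -> : u *: rodrigues beta (b :: A) + v *: rodrigues beta A =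
    multiplier (prodXD A) seed.
  rewrite /rodrigues prodXD_cons [_ * prodXD A]mulrC multiplierM /= addSn -/M.
  by rewrite /seed multiplierDr !multiplierZr.
rewrite -[size A]add0n; apply: alternates_multiplier_prodXD => //.
  rewrite dvdp_add // -mul_polyC dvdp_mull // ?dvdp_exp2l ?leq_addr //.
  rewrite -[X in multiplier _ X]mulr1 multiplier_euler_factor.
  by rewrite dvdp_mulr // dvdp_exp2l ?leq_addr.
(* If [seed] were 0, its constant coefficient would give [v = - u b], and the next one
   [- u (b + 1 + M) = 0]. *)
apply: alternates0; apply: contraTneq uv => seed0.
have E0 := congr1 (fun f : {poly R} => f`_0) seed0.
have E1 := congr1 (fun f : {poly R} => f`_1) seed0.
rewrite coef0 coefD !coefZ coef_multiplier !coef0_1subX_exp hornerXD add0r !mulr1 in E0.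
rewrite coef0 coefD !coefZ coef_multiplier !coef1_1subX_exp hornerXD in E1.
have def_v : v = - (u * b) by rewrite -[LHS](addKr (u * b)) E0 addr0.
have : - u * (b + 1 + M%:R) = 0 by rewrite -E1 def_v -natr1; ring.
move/eqP; rewrite mulf_eq0 oppr_eq0 -[_ + _ == 0]negbK gt0_addnat_neq0 ?addr_gt0 //=.
by rewrite orbF => /eqP u0; rewrite def_v u0 mul0r oppr0 eqxx.
Qed.

Lemma core_zeros_raise beta A b s w : {in b :: A, forall a, 0 < a} ->
  core_zeros beta (b :: A) s -> core_zeros beta A w ->
  forall i, (i < size A)%N -> s`_i <= w`_i <= s`_i.+1.
Proof.
move=> bA_gt0 sP wP i lt_iA.
have b_gt0 : 0 < b by rewrite bA_gt0 ?mem_head.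
have A_gt0 : {in A, forall a, 0 < a}.
  by move=> a aA; rewrite bA_gt0 // in_cons aA orbT.
have [||||le_sw lt_ws] :=
  @core_zeros_interlace (size A) beta (b :: A) A s w bA_gt0 A_gt0 _ _ _ _
    sP wP => //=.
- by move=> u v; apply: rodrigues_raise_pencil_alternates.
- rewrite prodXD_cons !hornerM !hornerXD add0r addSn -natr1.
  have P0 := prodXD_nat_gt0 0 A_gt0; have P1 := prodXD_nat_gt0 1 A_gt0.
  have : 0 < (prodXD A).[0] * (prodXD A).[1] by rewrite mulr_gt0.
  have := ler0n R (size A + beta).
  set M := _%:R; set P := _ * _ => M_ge0 P_gt0; rewrite -subr_gt0.
  have -> : (M + 1) * ((1 + b) * (prodXD A).[1] * (prodXD A).[0])
      - M * (b * (prodXD A).[0] * (prodXD A).[1]) = (M + 1 + b) * P.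
    by rewrite /P; ring.
  by rewrite mulr_gt0 // ltr_wpDl // addr_ge0.
by rewrite le_sw ?ltW ?lt_ws // ltnW.
Qed.

Lemma core_zeros_cons_lt beta A b c s w :
  {in A, forall a, 0 < a} -> 0 < b -> b < c ->
  core_zeros beta (b :: A) s -> core_zeros beta (c :: A) w ->
  forall i, (i <= size A)%N -> s`_i <= w`_i.
Proof.
move=> A_gt0 b_gt0 lt_bc sP wP i le_iA; have c_gt0 := lt_trans b_gt0 lt_bc.
have [||||||le_sw _] :=
  @core_zeros_interlace (size A) beta (b :: A) (c :: A) s w _ _ _ _ _ _
    sP wP => //=.
- by move=> a; rewrite in_cons => /predU1P[->|/A_gt0].
- by move=> a; rewrite in_cons => /predU1P[->|/A_gt0].
- by move=> u v; apply: rodrigues_cons_pencil_alternates; rewrite // lt_eqF.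
- rewrite ltr_pM2l ?ltr0n // !prodXD_cons !hornerM !hornerXD !add0r.
  have P0 := prodXD_nat_gt0 0 A_gt0; have P1 := prodXD_nat_gt0 1 A_gt0.
  have P_gt0 : 0 < (prodXD A).[0] * (prodXD A).[1] by rewrite mulr_gt0.
  rewrite -subr_gt0.
  set lhs := _ - _; have -> : lhs = (c - b) * ((prodXD A).[0] * (prodXD A).[1]).
    by rewrite /lhs; ring.
  by rewrite mulr_gt0 // subr_gt0.
by apply: le_sw; rewrite ltnS.
Qed.

(** The exponents are raised one at a time, each raised one being moved into [B]. Intermediate
    multisets may have repeated elements; Rodrigues polynomials still make sense for them. *)
Lemma core_zeros_le beta A A' B s w :
  {in A ++ B, forall a, 0 < a} -> all2 <=%R A A' ->
  core_zeros beta (A ++ B) s -> core_zeros beta (A' ++ B) w ->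
  forall i, (i < size (A ++ B))%N -> s`_i <= w`_i.
Proof.
elim: A A' B s => [|a A IHA] [|a' A'] B s //= AB_gt0.
  by move=> _ sP wP i _; rewrite (core_zeros_inj AB_gt0 sP wP).
case/andP=> le_aa' le_AA' sP wP i lt_i.
have a_gt0 : 0 < a by rewrite AB_gt0 ?mem_head.
have AB_gt0' : {in A ++ B, forall b, 0 < b}.
  by move=> b bAB; rewrite AB_gt0 // in_cons bAB orbT.
have a'_gt0 : 0 < a' := lt_le_trans a_gt0 le_aa'.
have a'AB_gt0 : {in a' :: A ++ B, forall b, 0 < b}.
  by move=> b; rewrite in_cons => /predU1P[->|/AB_gt0'].
have [t tP] := core_zeros_exist beta a'AB_gt0.
have le_st : s`_i <= t`_i.
  move: le_aa'; rewrite le_eqVlt => /predU1P[eq_aa'|lt_aa'].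
    by rewrite -eq_aa' in tP; rewrite (core_zeros_inj AB_gt0 sP tP).
  exact: (core_zeros_cons_lt AB_gt0' a_gt0 lt_aa' sP tP).
apply: le_trans le_st _.
have mid C : perm_eq (a' :: C ++ B) (C ++ a' :: B).
  by rewrite perm_sym perm_catC /= perm_cons perm_catC.
apply: (IHA A' (a' :: B) t) => //.
- by move=> b; rewrite -(perm_mem (mid A)); apply: a'AB_gt0.
- exact: perm_core_zeros (mid A) tP.
- exact: perm_core_zeros (mid A') wP.
- by rewrite -(perm_size (mid A)).
Qed.

End Zeros.

(** * Shifting one progression by 2 *)

Section Shift.
Variable R : realType.
Implicit Types (a b : R) (A B : seq R) (beta : nat).

(* At the zeros of the polynomial of [block a], [block_contiguous] makes that
   of [block (a + 2)] a positive multiple of that of [block (a + 1)], and the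
   sign of the latter alternates. *)
Lemma block_pencil_alternates beta a n (u v : R) :
  0 < a -> (u != 0) || (v != 0) ->
  alternates n (u *: rodrigues beta (block a n.+1)
                + v *: rodrigues beta (block (a + 2) n.+1)).
Proof.
move=> a_gt0 uv; have a1_gt0 : 0 < a + 1 by rewrite addr_gt0.
have A_gt0 : {in block (a + 1) n, forall b, 0 < b} by apply: block_gt0.
have aA_gt0 : {in block a n.+1, forall b, 0 < b} by apply: block_gt0.
have aA1_gt0 : {in block (a + 1) n.+1, forall b, 0 < b} by apply: block_gt0.
have eqJ1 : rodrigues beta (block (a + 1) n.+1) =
    rodrigues beta ((a + 1 + n%:R) :: block (a + 1) n).
  exact: perm_rodrigues (perm_blockSr _ _).
(* The blocks at [a] and [a + 1] share [block (a + 1) n] and differ only by [a] against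
   [a + 1 + n]. *)
have alt_J01 : pencil_alternates n (rodrigues_core beta (block a n.+1))
    (rodrigues_core beta (block (a + 1) n.+1)).
  apply: (pencil_alternates_multl (@exp_1subX_gt0 R beta)) => {uv}u {}v uv.
  rewrite -!rodriguesE blockS eqJ1 -[X in alternates X](size_block (a + 1)).
  apply: rodrigues_cons_pencil_alternates => //.
  by rewrite lt_eqF // -addrA ltrDl ltr_pwDl.
have [s sP] := core_zeros_exist beta aA_gt0; have [s_lt s01 def_s] := sP.
have := size_core_zeros aA_gt0 sP; rewrite size_block => sz_s.
have s_gt0 : {in s, forall z, 0 < z} by move=> z /s01/andP[].
have sgn_J1 i : (i <= n)%N ->
    0 < (-1) ^+ i * (rodrigues_core beta (block (a + 1) n.+1)).[s`_i].
  move=> le_in; have lt_is : (i < size s)%N by rewrite sz_s.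
  apply: (pencil_sign alt_J01) => //; rewrite ?size_rodrigues_core ?size_block //.
    rewrite wronskian_rodrigues_core0 !size_block -mulrBr pmulr_rlt0 ?ltr0n //.
    by rewrite subr_lt0 prodXD_block_ratio_lt // ltrDl.
  exact: rodrigues_core_gt0.
have Jrod b : rodrigues beta (block b n.+1) =
    multiplier (prodXD (block b n.+1)) ((1 - 'X) ^+ (n.+1 + beta)).
  by rewrite /rodrigues size_block.
have J0s i : (i <= n)%N -> (rodrigues beta (block a n.+1)).[s`_i] = 0.
  move=> le_in; rewrite rodriguesE hornerM def_s hornerZ.
  rewrite (rootP (_ : root (\prod_(x <- s) _) _)) ?mulr0 // root_prod_XsubC.
  by rewrite mem_nth // sz_s.
have sgn_J2 i : (i <= n)%N ->
    0 < (-1) ^+ i * (rodrigues beta (block (a + 2) n.+1)).[s`_i].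
  move=> le_in; have sis : s`_i \in s by rewrite mem_nth // sz_s.
  have /andP[si_gt0 _] := s01 _ sis.
  (* The contiguous relation at [s_i], with [x0], [x1], [x2] the values for [a], [a + 1],
     [a + 2]. *)
  have step (c d e z x0 x1 x2 : R) : c * (z * x2) = d * x1 - e * x0 -> x0 = 0 ->
      0 < c -> 0 < z -> 0 < d -> 0 < (-1) ^+ i * x1 -> 0 < (-1) ^+ i * x2.
    move=> E x0_eq0 c_gt0 z_gt0 d_gt0 x1_gt0.
    rewrite -(pmulr_rgt0 _ z_gt0) -(pmulr_rgt0 _ c_gt0).
    have -> : c * (z * ((-1) ^+ i * x2)) = (-1) ^+ i * (c * (z * x2)) by ring.
    by rewrite E x0_eq0 mulr0 subr0 mulrCA pmulr_rgt0.
  have := congr1 (horner^~ s`_i) (block_contiguous a n (n.+1 + beta)).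
  rewrite /= -!Jrod !(hornerD, hornerN, hornerZ, hornerM, hornerX, hornerC).
  move=> /step; apply=> //; first exact: J0s.
  - by rewrite addr_gt0 // ltr_wpDr.
  - by rewrite addr_gt0 // mulr_gt0 // addr_gt0 // addr_gt0 // ltr_wpDr.
  - by rewrite rodriguesE hornerM mulrCA pmulr_rgt0 ?sgn_J1 ?exp_1subX_gt0 ?s01.
apply: (alternates_pencil_at_zeros _ s_lt s01 sz_s J0s sgn_J2) uv.
apply: (@alternatesW _ _ n.+1) => //; rewrite rodriguesE.
apply/(alternates_mulr _ _ (@exp_1subX_gt0 R beta)).
by have := alternates_rodrigues_core beta aA_gt0; rewrite size_block.
Qed.

(** The last inequality of the squeeze. The operators of [B] carry the one-block pencil to the full
    one; for an empty block the two lists of zeros coincide. *)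
Lemma core_zeros_block_lt beta a n B s w :
  0 < a -> {in B, forall b, 0 < b} ->
  core_zeros beta (block a n ++ B) s ->
  core_zeros beta (block (a + 2) n ++ B) w ->
  forall i, (i.+1 < n + size B)%N -> w`_i < s`_i.+1.
Proof.
move=> a_gt0 B_gt0; have a2_gt0 : 0 < a + 2 by rewrite addr_gt0.
have gt0_cat c : 0 < c -> {in block c n ++ B, forall b, 0 < b}.
  by move=> c_gt0 b; rewrite mem_cat => /orP[/(block_gt0 c_gt0)|/B_gt0].
have aB_gt0 := gt0_cat _ a_gt0; have a2B_gt0 := gt0_cat _ a2_gt0.
case: n => [|n] in gt0_cat aB_gt0 a2B_gt0 * => sP wP i lt_i.
  rewrite (core_zeros_inj B_gt0 wP sP); have [s_lt _ _] := sP.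
  by apply: (sortedP 0 s_lt); rewrite (size_core_zeros B_gt0 sP).
have [||||_ lt_ws] := @core_zeros_interlace _ (n + size B) beta _ _ s w
    aB_gt0 a2B_gt0 _ _ _ _ sP wP; last by apply: lt_ws; rewrite size_cat size_block.
- by rewrite size_cat size_block.
- by rewrite !size_cat !size_block.
- move=> u v uv.
  rewrite 2!rodrigues_cat -multiplier_linearr.
  apply: alternates_multiplier_prodXD => //; last exact: block_pencil_alternates.
  rewrite dvdp_add // -mul_polyC dvdp_mull //.
    by rewrite (dvdp_trans _ (dvdp_rodrigues _ _)) // dvdp_exp2l ?leq_addr.
  by rewrite (dvdp_trans _ (dvdp_rodrigues _ _)) // dvdp_exp2l ?leq_addr.
- rewrite !size_cat !size_block ltr_pM2l ?ltr0n // !prodXD_cat !hornerM.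
  have P0 := prodXD_nat_gt0 0 B_gt0; have P1 := prodXD_nat_gt0 1 B_gt0.
  rewrite mulrACA [ltRHS]mulrACA [X in _ < _ * X]mulrC ltr_pM2r ?mulr_gt0 //.
  by rewrite prodXD_block_ratio_lt // ltrDl.
Qed.

End Shift.

(** * Jacobi-Pineiro polynomials *)

Section JacobiPineiro.
Variables (R : realType) (r : nat).
Implicit Types (alpha : 'rV[R]_r) (n : 'rV[nat]_r) (i j : 'I_r).

(** The list [s] of indices is a parameter so that the block of one index can be isolated. *)
Definition exponents alpha n (s : seq 'I_r) : seq R :=
  [seq alpha 0 j + 1 + k%:R | j <- s, k <- iota 0 (n 0 j)].

Lemma exponentsE alpha n s : exponents alpha n s =
  flatten [seq block (alpha 0 j + 1) (n 0 j) | j <- s].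
Proof. by []. Qed.

Lemma size_exponents alpha n :
  size (exponents alpha n (enum 'I_r)) = (\sum_(j < r) n 0%R j)%N.
Proof.
rewrite size_allpairs_dep sumnE big_map big_enum /=.
by apply: eq_bigr => j _; rewrite size_iota.
Qed.

Lemma exponents_gt0 alpha n s : (forall j, -1 < alpha 0 j) ->
  {in exponents alpha n s, forall b, 0 < b}.
Proof.
move=> alpha_gtN1 b /allpairsPdep[j [k [_ _ ->]]].
by rewrite ltr_wpDr // -ltrBlDr sub0r.
Qed.

Lemma uniq_exponents alpha n s : uniq s ->
  (forall j k : 'I_r, j != k -> alpha 0 j - alpha 0 k \isn't a Num.int) ->
  uniq (exponents alpha n s).
Proof.
move=> uniq_s alpha_diff; apply: allpairs_uniq_dep => //.
  by move=> j _; apply: iota_uniq.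
move=> [j k] [j' k'] _ _ /= E.
have eq_jj' : j = j'.
  have [//|/alpha_diff/negP[]] := eqVneq j j'.
  have -> : alpha 0 j - alpha 0 j' = k'%:R - k%:R by lra.
  by rewrite rpredB ?rpred_nat.
case: _ / eq_jj' in k' E *; congr Tagged.
by apply/eqP; rewrite -(eqr_nat R); apply/eqP; move: E => /addrI.
Qed.

(** The Rodrigues polynomial has the required vanishing moments; conversely, [moments_eq0] inverts
    the operators and a degree count gives uniqueness. *)
Lemma jacobi_pineiroE alpha beta n (A : seq R) :
  (forall j, -1 < alpha 0 j) ->
  (forall j k : 'I_r, j != k -> alpha 0 j - alpha 0 k \isn't a Num.int) ->
  A = exponents alpha n (enum 'I_r) ->
  jacobi_pineiro alpha beta n =
    (lead_coef (rodrigues_core beta A))^-1 *: rodrigues_core beta A.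
Proof.
move=> alpha_gtN1 alpha_diff def_A; set q := rodrigues_core beta A.
have A_gt0 : {in A, forall b, 0 < b} by rewrite def_A; apply: exponents_gt0.
have uniq_A : uniq A by rewrite def_A uniq_exponents ?enum_uniq.
have sz_A : size A = (\sum_(j < r) n 0%R j)%N by rewrite def_A size_exponents.
have lq_neq0 : lead_coef q != 0 := lead_rodrigues_core_neq0 beta A_gt0.
apply: xget_unique => [|p]; rewrite /= is_jacobi_pineiroE //.
  split.
  - by rewrite monicE lead_coefZ mulVf.
  - by rewrite size_scale ?invr_eq0 // size_rodrigues_core // sz_A.
  move=> j k lt_kn; rewrite -scalerAr -rodriguesE momentE.
  have -> c F : antieuler c ((lead_coef q)^-1 *: F) =
      (lead_coef q)^-1 *: antieuler c F.
    by apply/polyP => m; rewrite !(coefZ, coef_antieuler) mulrA.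
  rewrite hornerZ -momentE moment_rodrigues ?mulr0 // def_A.
  by apply/allpairsPdep; exists j, k; rewrite mem_enum mem_iota.
move=> [p_monic sz_p mom_p].
have [||H [defF dvdH leH]] :=
  @moments_eq0 _ A beta ((1 - 'X) ^+ beta * p) uniq_A A_gt0.
- exact: dvdp_mulr.
- rewrite def_A => b /allpairsPdep[j [k [_ + ->]]]; rewrite mem_iota => /= lt_kn.
  exact: mom_p.
case/dvdpP: dvdH => h def_H.
have nz_p : p != 0 by rewrite monic_neq0.
have nz_h : h != 0.
  apply: contraNneq nz_p => h0; rewrite def_H h0 mul0r in defF.
  have : multiplier (prodXD A) 0 = 0.
    by apply/polyP => k; rewrite coef_multiplier coef0 mulr0.
  rewrite -defF => /eqP; rewrite mulf_eq0 => /orP[|//].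
  by rewrite (negPf (exp_1subX_neq0 R beta)).
(* [H] has degree at most [beta + size A] and is divisible by [(1 - x)] to that power, so the
   quotient is constant. *)
have sz_h : (size h <= 1)%N.
  move: leH; rewrite def_H !size_mul ?exp_1subX_neq0 // !size_1subX_exp sz_p -sz_A.
  by rewrite !addnS addSn /= -[(beta + size A).+1]add1n leq_add2r.
have def_p : p = h`_0 *: q.
  apply: (mulfI (exp_1subX_neq0 R beta)); rewrite defF def_H (size1_polyC sz_h).
  rewrite mul_polyC multiplierZr -scalerAr -rodriguesE /rodrigues coefC.
  by rewrite [in RHS]addnC.
have : lead_coef p = 1 by apply/eqP; rewrite -monicE.
rewrite {1}def_p lead_coefZ => lp1; rewrite def_p; congr (_ *: _).
by rewrite -[LHS](mulfK lq_neq0) lp1 mul1r.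
Qed.

Lemma exponents_cons alpha n i s :
  exponents alpha n (i :: s) =
  block (alpha 0 i + 1) (n 0 i) ++ exponents alpha n s.
Proof. by []. Qed.

Lemma perm_exponents alpha n s s' : perm_eq s s' ->
  perm_eq (exponents alpha n s) (exponents alpha n s').
Proof. by move=> eq_ss'; apply: perm_flatten; apply: perm_map. Qed.

Lemma eq_in_exponents alpha alpha' n n' s :
  {in s, forall j, alpha 0 j = alpha' 0 j} ->
  {in s, forall j, n 0 j = n' 0 j} ->
  exponents alpha n s = exponents alpha' n' s.
Proof.
move=> eq_alpha eq_n; rewrite !exponentsE; congr flatten.
by apply/eq_in_map => j js; rewrite eq_alpha // eq_n.
Qed.

End JacobiPineiro.

Lemma ordered_zeros_core (R : realType) beta (A s : seq R) :
  {in A, forall b, 0 < b} -> core_zeros beta A s ->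
  ordered_zeros
    ((lead_coef (rodrigues_core beta A))^-1 *: rodrigues_core beta A) s.
Proof.
move=> A_gt0 [s_lt _ def_s]; have lq_neq0 := lead_rodrigues_core_neq0 beta A_gt0.
split.
- by rewrite scaler_eq0 invr_eq0 -lead_coef_eq0 (negPf lq_neq0).
- by apply: sub_sorted s_lt => x y /ltW.
- by rewrite lead_coefZ mulVf // scale1r {2}def_s scalerA mulVf // scale1r.
Qed.

Theorem theorem5p2 (R : realType) (r : nat) (n : 'rV[nat]_r) (beta : nat)
    (alpha : 'rV[R]_r)
    (n_gt0 : forall j : 'I_r, (0 < n 0%R j)%N)
    (alpha_gtN1 : forall j : 'I_r, -1 < alpha 0 j)
    (alpha_diff : forall j k : 'I_r, j != k ->
       alpha 0 j - alpha 0 k \isn't a Num.int)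
    (i : 'I_r) (t : R) (t_itv : 0 <= t <= 2)
    (alpha_shift : forall j : 'I_r, j != i ->
       alpha 0 i - alpha 0 j + t \isn't a Num.int) :
  interlaces (jacobi_pineiro alpha beta (n + delta_mx 0 i))
             (jacobi_pineiro alpha beta n) /\
  interlaces (jacobi_pineiro alpha beta n)
             (jacobi_pineiro (alpha + t *: delta_mx 0 i) beta n).
Proof.
have /andP[t_ge0 t_le2] := t_itv; set alpha' := alpha + t *: delta_mx 0 i.
have alpha'i : alpha' 0 i = alpha 0 i + t by rewrite !mxE !eqxx mulr1.
have alpha'j j : j != i -> alpha' 0 j = alpha 0 j.
  by move=> /negPf neq_ji; rewrite !mxE neq_ji andbF mulr0 addr0.
have alpha'_gtN1 j : -1 < alpha' 0 j.
  have [->|/alpha'j-> //] := eqVneq j i.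
  by rewrite alpha'i (lt_le_trans (alpha_gtN1 i)) // lerDl.
have alpha'_diff j k : j != k -> alpha' 0 j - alpha' 0 k \isn't a Num.int.
  have [->|ji] := eqVneq j i; have [->|ki] := eqVneq k i; rewrite ?eqxx //.
  - by move=> _; rewrite alpha'i alpha'j // addrAC alpha_shift.
  - move=> _; rewrite alpha'i alpha'j // -opprB rpredN.
    by rewrite addrAC alpha_shift.
  - by rewrite !alpha'j //; apply: alpha_diff.
pose s := rem i (enum 'I_r); pose B := exponents alpha n s.
have perm_i : perm_eq (enum 'I_r) (i :: s) by rewrite perm_to_rem ?mem_enum.
have s_neq j : j \in s -> j != i.
  by apply: contraTneq => ->; rewrite mem_rem_uniqF ?enum_uniq.
pose a := alpha 0 i + 1; pose blk c := block c (n 0 i) ++ B.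
have a_gt0 : 0 < a by rewrite -ltrBlDr sub0r.
have B_gt0 : {in B, forall b, 0 < b} by apply: exponents_gt0.
have blk_gt0 c : a <= c -> {in blk c, forall b, 0 < b}.
  move=> le_ac b; rewrite mem_cat => /orP[|/B_gt0//].
  exact/block_gt0/(lt_le_trans a_gt0).
have at_ge : a <= a + t by rewrite lerDl.
have a2_ge : a <= a + 2 by rewrite lerDl.
(* The exponent that [n + e_i] adds to the block of [i]. *)
pose b := a + (n 0 i)%:R.
have b_gt0 : 0 < b by rewrite ltr_wpDr.
have bblk_gt0 : {in b :: blk a, forall b, 0 < b}.
  by move=> c; rewrite in_cons => /predU1P[->//|/(blk_gt0 _ (lexx a))].
have perm_A : perm_eq (exponents alpha n (enum 'I_r)) (blk a).
  exact: perm_exponents perm_i.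
have perm_A1 :
    perm_eq (exponents alpha (n + delta_mx 0 i) (enum 'I_r)) (b :: blk a).
  apply: perm_trans (perm_exponents _ _ perm_i) _; rewrite exponents_cons.
  have -> : exponents alpha (n + delta_mx 0 i) s = B.
    apply: eq_in_exponents => // j /s_neq/negPf neq_ji.
    by rewrite !mxE neq_ji andbF addr0.
  have -> : (n + delta_mx 0 i) 0 i = (n 0 i).+1 by rewrite !mxE !eqxx addrC.
  by rewrite -cat_cons perm_cat2r perm_blockSr.
have perm_At : perm_eq (exponents alpha' n (enum 'I_r)) (blk (a + t)).
  apply: perm_trans (perm_exponents _ _ perm_i) _; rewrite exponents_cons.
  have -> : exponents alpha' n s = B.
    by apply: eq_in_exponents => // j /s_neq; apply: alpha'j.
  by rewrite alpha'i addrAC.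
have [s0 s0P] := core_zeros_exist beta (blk_gt0 _ (lexx a)).
have [s1 s1P] := core_zeros_exist beta bblk_gt0.
have [st stP] := core_zeros_exist beta (blk_gt0 _ at_ge).
have [s2 s2P] := core_zeros_exist beta (blk_gt0 _ a2_ge).
have sz_blk c : size (blk c) = (n 0%R i + size B)%N by rewrite size_cat size_block.
have sz0 : size s0 = size (blk a) := size_core_zeros (blk_gt0 _ (lexx a)) s0P.
have sz1 : size s1 = (size (blk a)).+1 := size_core_zeros bblk_gt0 s1P.
have szt : size st = size (blk a).
  by rewrite (size_core_zeros (blk_gt0 _ at_ge) stP) !sz_blk.
rewrite !(jacobi_pineiroE _ _ _ erefl) //.
rewrite !(perm_rodrigues_core _ perm_A) (perm_rodrigues_core _ perm_A1).
rewrite (perm_rodrigues_core _ perm_At); split.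
  exists s1, s0; split; try exact: ordered_zeros_core.
    by apply: ordered_zeros_core => //; apply: blk_gt0.
  right; rewrite sz1 sz0; split=> // k lt_k.
  exact: core_zeros_raise bblk_gt0 s1P s0P k lt_k.
exists s0, st; split; try by apply: ordered_zeros_core => //; apply: blk_gt0.
left; rewrite szt sz0; split=> // k lt_k.
  exact: (core_zeros_le (blk_gt0 _ (lexx a)) (all2_le_block _ at_ge) s0P stP).
have lt_k' : (k < size (blk (a + t)%R))%N by rewrite sz_blk -(sz_blk a) ltnW.
(* The zeros for shift [t] lie below those for shift 2, which lie below the next zeros for shift
   0. *)
have le_t2 : a + t <= a + 2 by rewrite lerD2l.
have := core_zeros_le (blk_gt0 _ at_ge) (all2_le_block _ le_t2) stP s2P lt_k'.
move=> /le_trans; apply.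
by rewrite ltW // (core_zeros_block_lt a_gt0 B_gt0 s0P s2P) // -(sz_blk a).
Qed.
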